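(* Fix any probability measure $\lambda$ on $\mathbb R^d$. Then the embedding $P\mapsto P\lambda$ from $(\mathcal P^{++},d_B)$ into $(\mathbb P^+,d_{KB})$ is a totally geodesic map (it maps geodesics to geodesics), and for all $P_0,P_1\in\mathcal P^{++}$ $$d_B(P_0,P_1)=d_{KB}(P_0\lambda,P_1\lambda)=d_H(P_0\lambda,P_1\lambda).$$
   Context: Fix $d\ge 1$. $\mathcal S$ is the space of symmetric real $d\times d$ matrices, $\mathcal P^+\subset\mathcal S$ the positive-semidefinite ones, $\mathcal P^{++}$ the positive-definite ones, $A:B=\mathrm{Tr}(AB^\top)$, $A^{Sym}=\frac12(A+A^\top)$. Bures metric: $\mathcal P^{++}$ is a smooth manifold (open in $\mathcal S$) with $T_P\mathcal P^{++}\cong\mathcal S$. For $\Xi\in T_P\mathcal P^{++}$ let $U_\Xi\in\mathcal S$ be the unique solution of $2\Xi=PU_\Xi+U_\Xi P$. The Bures Riemannian metric is $\langle\Xi_1,\Xi_2\rangle_P=PU_{\Xi_1}:U_{\Xi_2}$, and $d_B$ is the corresponding Riemannian distance on $\mathcal P^{++}$. $\mathbb P^+$ is the set of $\mathcal P^+$-valued Radon measures $G$ on $\mathbb R^d$ with finite mass $\mathrm{Tr}\,G(\mathbb R^d)$. For a matrix measure $G=g\,\mu$ with $\mu=\mathrm{Tr}\,G$, and vector fields $u,v$ and matrix fields $U,V$, write $\int \mathrm dG\,u\cdot v=\int gu\cdot v\,\mathrm d\mu$, $\int \mathrm dG\,U:V=\int (gU):V\,\mathrm d\mu$. $\mathcal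 C_w([0,1];\mathbb P^+)$ is the set of curves $t\mapsto G_t\in\mathbb P^+$ continuous for narrow convergence (convergence of $\int\phi\,\mathrm dG$ for all bounded continuous scalar $\phi$). For $G\in\mathcal C_w([0,1];\mathbb P^+)$, $L^2(0,1;L^2(\mathrm dG_t))$ is the Hilbert space obtained from $\mathcal C^1_b([0,1]\times\mathbb R^d;\mathcal S\times\mathbb R^d)$ ($\mathcal C^1$, bounded with bounded first derivatives) by quotienting by the kernel of, and completing with respect to, the seminorm $$\|\mathfrak U\|^2_{L^2(0,1;L^2(\mathrm dG_t))}=\int_0^1\Big(\int_{\mathbb R^d}\mathrm dG_t\,u_t\cdot u_t+\int_{\mathbb R^d}\mathrm dG_t\,U_t:U_t\Big)\mathrm dt,\qquad \mathfrak U=(U,u).$$ Its elements are rendered as pairs $\mathfrak U=(U,u)$ of an $\mathcal S$-valued and an $\mathbb R^d$-valued square-integrable field. The pair $(G_t,\mathfrak U_t)_{t\in[0,1]}$, $\mathfrak U_t=(U_t,u_t)$, belongs to the admissible set $\mathcal A(G_0,G_1)$ if $G\in\mathcal C_w([0,1];\mathbb P^+)$, $G|_{t=0}=G_0$, $G|_{t=1}=G_1$, $\mathfrak U\in L^2(0,1;L^2(\mathrm dG_t))$, and $\partial_tG_t=\{-\nabla(G_tu_t)+G_tU_t\}^{Sym}$ in the weak sense, i.e. $$\int_{\mathbb R^d}\Phi_t:\mathrm dG_t-\int_{\mathbb R^d}\Phi_s:\mathrm dG_s-\int_s^t\int_{\mathbb R^d}\mathrm dG_\tau:\partial_\tau\Phi_\tau\,\mathrm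 d\tau=\int_s^t\int_{\mathbb R^d}(\mathrm dG_\tau u_\tau\cdot\operatorname{div}\Phi_\tau+\mathrm dG_\tau U_\tau:\Phi_\tau)\,\mathrm d\tau$$ for all $\Phi\in\mathcal C^1_b([0,1]\times\mathbb R^d;\mathcal S)$ and $t,s\in[0,1]$ ($\operatorname{div}$ is the row-wise divergence). The Kantorovich-Bures distance on $\mathbb P^+$ is $d_{KB}(G_0,G_1)=\big(\inf_{\mathcal A(G_0,G_1)}\|\mathfrak U\|^2_{L^2(0,1;L^2(\mathrm dG_t))}\big)^{1/2}$. The distance $d_H$ on $\mathbb P^+$ is defined by the same formula with the infimum restricted to the admissible paths with $u\equiv0$. ''Geodesic'' means constant-speed minimizing metric geodesic. *)

(* Defs.v *)
From HB Require Import structures.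
From mathcomp Require Import all_boot all_order all_algebra.
From mathcomp Require Import all_classical all_reals all_analysis.

Set Implicit Arguments.
Unset Strict Implicit.
Unset Printing Implicit Defensive.

Import Order.TTheory GRing.Theory Num.Theory.
Import numFieldNormedType.Exports.

Local Open Scope classical_set_scope.
Local Open Scope ring_scope.
Local Open Scope charge_scope.

(* Matrix spaces, in particular R^d = 'cV[R]_d, carry their Borel sigma-algebra. *)
HB.instance Definition _ (R : realType) (m n : nat) :=
  @isMeasurable.Build (sigma_display (@open 'M[R]_(m, n))) 'M[R]_(m, n)
    <<s @open 'M[R]_(m, n) >> (@sigma_algebra0 _ setT _) (@sigma_algebraC _ _)
    (@sigma_algebra_bigcup _ setT _).

Section Matrices.
Context {R : realType}.

(* A : B = Tr (A B^T); on column vectors this is the dot product. *)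
Definition inner m n (A B : 'M[R]_(m, n)) : R := \tr (A *m B^T).

Definition psdmx d (P : 'M[R]_d) : Prop :=
  P^T = P /\ forall v : 'cV[R]_d, 0 <= inner (P *m v) v.

Definition pdmx d (P : 'M[R]_d) : Prop :=
  P^T = P /\ forall v : 'cV[R]_d, v != 0 -> 0 < inner (P *m v) v.

Record pdMatrix (d : nat) := PdMatrix { pdval :> 'M[R]_d ; pdvalP : pdmx pdval }.

Lemma psdmx0 d : @psdmx d 0.
Proof.
by split=> [|v]; rewrite ?trmx0// /inner mul0mx mul0mx mxtrace0.
Qed.

Lemma psdmxZ d (P : 'M[R]_d) (a : R) : 0 <= a -> pdmx P -> psdmx (a *: P).
Proof.
move=> a0 [Psym Ppos]; split=> [|v]; first by rewrite linearZ /= Psym.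
have [->|v0] := eqVneq v 0; first by rewrite /inner mulmx0 mul0mx mxtrace0.
by rewrite /inner -!scalemxAl mxtraceZ mulr_ge0// ltW// Ppos.
Qed.

Lemma psdmx_diag d (P : 'M[R]_d) i : psdmx P -> 0 <= P i i.
Proof.
move=> [_ /(_ (delta_mx i 0))].
by rewrite /inner trmx_delta mxtrace_mulC -colE -rowE trace_mx11 !mxE.
Qed.

Lemma psdmx_tr d (P : 'M[R]_d) : psdmx P -> 0 <= \tr P.
Proof. by move=> Ppsd; apply: sumr_ge0 => i _; exact: psdmx_diag. Qed.

End Matrices.

Arguments pdMatrix R d : clear implicits.
Arguments pdval {R d} _.
Arguments PdMatrix {R d} _ _.

(* Finite mass is automatic since the values are real matrices; finite Borel
   measures on R^d are Radon.  As for the library's measures, the values on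
   non-measurable sets carry no information. *)
Record psdMeasure (R : realType) (d : nat) := PsdMeasure {
  mval :> set 'cV[R]_d -> 'M[R]_d ;
  mval_psd : forall A, psdmx (mval A) ;
  mval_sigma_additive : forall F : (set 'cV[R]_d)^nat,
    (forall n, measurable (F n)) -> trivIset setT F ->
    (fun n => \sum_(0 <= k < n) mval (F k)) @ \oo --> mval (\bigcup_n F n) }.

Definition meas_eq (R : realType) (d : nat) (G H : psdMeasure R d) : Prop :=
  forall A, measurable A -> G A = H A.

Section MatrixMeasure.
Context {R : realType} {d : nat}.
Variable G : psdMeasure R d.

Lemma mval_entry_cvg i j (F : (set 'cV[R]_d)^nat) :
  (forall n, measurable (F n)) -> trivIset setT F ->
  (fun n => \sum_(0 <= k < n) G (F k) i j) @ \oo --> G (\bigcup_n F n) i j.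
Proof.
move=> mF tF; have GF := @mval_sigma_additive _ _ G _ mF tF.
under eq_fun do rewrite -summxE.
exact: (cvg_comp _ _ GF (@coord_continuous R d d i j _)).
Qed.

Lemma mval0 : G set0 = 0.
Proof.
apply/matrixP => i j; rewrite mxE.
have := @mval_entry_cvg i j (fun=> set0) (fun=> measurable0)
  (@trivIset_set0 _ _ _).
rewrite bigcup0//; set a := G set0 i j => sa.
have sa1 : (fun n => \sum_(0 <= k < n.+1) a) @ \oo --> a.
  by move: sa; rewrite -(@cvg_shiftS _ _ (nbhs a)).
have : (fun n => \sum_(0 <= k < n.+1) a - \sum_(0 <= k < n) a) @ \oo --> a - a.
  exact: cvgB.
rewrite subrr; under eq_fun do rewrite big_nat_recr//= addrAC subrr add0r.
by move/(cvg_lim (@norm_hausdorff _ _)); rewrite lim_cst//; exact: norm_hausdorff.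
Qed.

Definition entry (i j : 'I_d) (A : set 'cV[R]_d) : \bar R := (G A i j)%:E.

Definition trace_measure (A : set 'cV[R]_d) : \bar R := (\tr (G A))%:E.

Section instances.
Variables i j : 'I_d.

Let entry0 : entry i j set0 = 0%E.
Proof. by rewrite /entry mval0 mxE. Qed.

Let entry_fin A : measurable A -> entry i j A \is a fin_num.
Proof. by []. Qed.

Let entry_sigma : semi_sigma_additive (entry i j).
Proof.
move=> F mF tF _; under eq_fun do rewrite sumEFin.
by apply: cvg_EFin; [near=> n|exact: mval_entry_cvg].
Unshelve. all: by end_near. Qed.

HB.instance Definition _ :=
  isCharge.Build _ _ _ (entry i j) entry0 entry_fin entry_sigma.

End instances.

Let trace0 : trace_measure set0 = 0%E.
Proof. by rewrite /trace_measure mval0 mxtrace0. Qed.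

Let trace_ge0 A : (0 <= trace_measure A)%E.
Proof. by rewrite lee_fin; apply/psdmx_tr/mval_psd. Qed.

Let trace_sigma : semi_sigma_additive trace_measure.
Proof.
move=> F mF tF _; under eq_fun do rewrite sumEFin.
apply: cvg_EFin; first by near=> n.
rewrite /mxtrace; under eq_fun do rewrite exchange_big /=.
apply: cvg_big => [|i _]; last exact: mval_entry_cvg.
exact: add_continuous.
Unshelve. all: by end_near. Qed.

HB.instance Definition _ :=
  isMeasure.Build _ _ _ trace_measure trace0 trace_ge0 trace_sigma.

Let trace_fin : fin_num_fun trace_measure.
Proof. by []. Qed.

HB.instance Definition _ :=
  Measure_isFinite.Build _ _ _ trace_measure trace_fin.

(* The density g in G = g mu, mu = Tr G. *)
Definition density (x : 'cV[R]_d) : 'M[R]_d :=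
  \matrix_(i, j) fine (('d (entry i j) '/d trace_measure) x).

Definition int_scalar (phi : 'cV[R]_d -> R) : 'M[R]_d :=
  \matrix_(i, j) Rintegral trace_measure setT (fun x => phi x * density x i j).

Definition int_mx (Phi : 'cV[R]_d -> 'M[R]_d) : R :=
  Rintegral trace_measure setT (fun x => inner (Phi x) (density x)).

(* int dG U : V for matrix fields (n = d), int dG u . v for vector fields
   (n = 1). *)
Definition int_pair n (U V : 'cV[R]_d -> 'M[R]_(d, n)) : R :=
  Rintegral trace_measure setT (fun x => inner (density x *m U x) (V x)).

Definition int_sq n (U : 'cV[R]_d -> 'M[R]_(d, n)) : \bar R :=
  \int[trace_measure]_x (inner (density x *m U x) (U x))%:E.

End MatrixMeasure.

Section Embedding.
Context {R : realType} {d : nat}.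
Variables (P : pdMatrix R d) (lambda : probability 'cV[R]_d R).

Definition scaled_val (A : set 'cV[R]_d) : 'M[R]_d := fine (lambda A) *: pdval P.

Let scaled_psd A : psdmx (scaled_val A).
Proof. by apply: psdmxZ; [exact/fine_ge0|exact: pdvalP]. Qed.

Let scaled_sigma (F : (set 'cV[R]_d)^nat) :
  (forall n, measurable (F n)) -> trivIset setT F ->
  (fun n => \sum_(0 <= k < n) scaled_val (F k)) @ \oo -->
    scaled_val (\bigcup_n F n).
Proof.
move=> mF tF; rewrite /scaled_val; under eq_fun do rewrite -scaler_suml.
apply: cvgZr_tmp.
have /fine_cvg : (fun n => \sum_(0 <= k < n) lambda (F k))%E @ \oo -->
    (fine (lambda (\bigcup_n F n)))%:E.
  rewrite fineK ?fin_num_measure//; last exact: bigcup_measurable.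
  exact: measure_sigma_additive.
apply: cvg_trans; apply: near_eq_cvg; near=> n => /=.
by rewrite -sum_fine// => k _; exact: fin_num_measure.
Unshelve. all: by end_near. Qed.

(* P |-> P lambda *)
Definition scaled_measure : psdMeasure R d :=
  PsdMeasure scaled_psd scaled_sigma.

End Embedding.

Section BuresMetric.
Context {R : realType} {d : nat}.

Definition lyapunov (P Xi : 'M[R]_d) : 'M[R]_d :=
  xget 0 [set U | U^T = U /\ 2%:R *: Xi = P *m U + U *m P].

Definition bures_metric (P Xi1 Xi2 : 'M[R]_d) : R :=
  inner (P *m lyapunov P Xi1) (lyapunov P Xi2).

Definition C1_curve (c : R -> 'M[R]_d) : Prop :=
  (forall t, derivable c t 1) /\ continuous (derive1 c).

(* Each piece is the restriction to [a, b] of a C^1 curve in the matrix space,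
   i.e. it is C^1 up to the end points. *)
Definition piecewise_C1 (c : R -> 'M[R]_d) : Prop :=
  exists s : seq R, [/\ path <%R 0 s, last 0 s = 1 &
    forall k, (k < size s)%N ->
      exists2 e : R -> 'M[R]_d, C1_curve e &
        forall t, nth 0 (0 :: s) k <= t <= nth 0 s k -> c t = e t].

(* The finitely many break points are negligible for the integral. *)
Definition bures_length (c : R -> 'M[R]_d) : \bar R :=
  \int[lebesgue_measure]_(t in `[0, 1])
    (Num.sqrt (bures_metric (c t) (derive1 c t) (derive1 c t)))%:E.

Definition bures_dist (P0 P1 : pdMatrix R d) : \bar R :=
  ereal_inf [set l | exists c : R -> pdMatrix R d,
    [/\ piecewise_C1 (pdval \o c), c 0 = P0 :> 'M[R]_d, c 1 = P1 :> 'M[R]_d &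
        l = bures_length (pdval \o c)]].

End BuresMetric.

Section KantorovichBures.
Context {R : realType} {d : nat}.

Definition strip : set (R * 'cV[R]_d) := `[0, 1] `*` setT.

(* C^1_b([0,1] x R^d): restrictions to the strip of functions that are C^1 on
   a neighbourhood ]-e, 1+e[ x R^d of it. *)
Definition C1b m n (f : R * 'cV[R]_d -> 'M[R]_(m, n)) : Prop :=
  [/\ exists2 e : R, 0 < e & forall p, - e < p.1 < 1 + e ->
        differentiable f p /\ forall v, {for p, continuous (fun q => 'D_v f q)},
      [bounded f p | p in strip] &
      forall v, [bounded 'D_v f p | p in strip]].

Definition symmetric_on_strip (f : R * 'cV[R]_d -> 'M[R]_d) : Prop :=
  forall p, strip p -> (f p)^T = f p.

Definition time_derivative m n (f : R * 'cV[R]_d -> 'M[R]_(m, n)) p :=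
  'D_(1, 0) f p.

Definition divergence (f : R * 'cV[R]_d -> 'M[R]_d) p : 'cV[R]_d :=
  \col_i \sum_j ('D_(0, delta_mx j 0) f p) i j.

Definition at_time (T : Type) (f : R * 'cV[R]_d -> T) (t : R) : 'cV[R]_d -> T :=
  fun x => f (t, x).

Definition oriented_integral (s t : R) (f : R -> R) : R :=
  if s <= t then Rintegral lebesgue_measure `[s, t] f
  else - Rintegral lebesgue_measure `[t, s] f.

Definition narrowly_continuous (G : R -> psdMeasure R d) : Prop :=
  forall phi : 'cV[R]_d -> R, continuous phi -> [bounded phi x | x in setT] ->
    {within `[0, 1], continuous (fun t => int_scalar (G t) phi)}.

(* The squared seminorm of (U, u). *)
Definition L2sq (G : R -> psdMeasure R d)
    (U : R * 'cV[R]_d -> 'M[R]_d) (u : R * 'cV[R]_d -> 'cV[R]_d) : \bar R :=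
  \int[lebesgue_measure]_(t in `[0, 1])
    (int_sq (G t) (at_time u t) + int_sq (G t) (at_time U t))%E.

Definition measurable_field m n (f : R * 'cV[R]_d -> 'M[R]_(m, n)) : Prop :=
  forall i j, measurable_fun strip (fun p => f p i j).

(* (U, u) represents an element of the completion: it is a limit, in the
   seminorm, of C^1_b fields. *)
Definition L2_field (G : R -> psdMeasure R d)
    (U : R * 'cV[R]_d -> 'M[R]_d) (u : R * 'cV[R]_d -> 'cV[R]_d) : Prop :=
  [/\ symmetric_on_strip U,
      measurable_field U /\ measurable_field u,
      (L2sq G U u < +oo)%E &
      forall e : R, 0 < e ->
        exists (V : R * 'cV[R]_d -> 'M[R]_d) (v : R * 'cV[R]_d -> 'cV[R]_d),
          [/\ C1b V, C1b v, symmetric_on_strip V &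
              (L2sq G (U \- V)%R (u \- v)%R < e%:E)%E]].

Definition weak_solution (G : R -> psdMeasure R d)
    (U : R * 'cV[R]_d -> 'M[R]_d) (u : R * 'cV[R]_d -> 'cV[R]_d) : Prop :=
  forall Phi : R * 'cV[R]_d -> 'M[R]_d, C1b Phi -> symmetric_on_strip Phi ->
  forall s t : R, 0 <= s <= 1 -> 0 <= t <= 1 ->
    int_mx (G t) (at_time Phi t) - int_mx (G s) (at_time Phi s)
    - oriented_integral s t
        (fun r => int_mx (G r) (at_time (time_derivative Phi) r))
    = oriented_integral s t
        (fun r => int_pair (G r) (at_time u r) (at_time (divergence Phi) r)
                + int_pair (G r) (at_time U r) (at_time Phi r)).

Definition admissible (G0 G1 : psdMeasure R d) (G : R -> psdMeasure R d)
    (U : R * 'cV[R]_d -> 'M[R]_d) (u : R * 'cV[R]_d -> 'cV[R]_d) : Prop :=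
  [/\ narrowly_continuous G, meas_eq (G 0) G0, meas_eq (G 1) G1,
      L2_field G U u & weak_solution G U u].

Definition KB_dist (G0 G1 : psdMeasure R d) : \bar R :=
  sqrte (ereal_inf [set e | exists G U u,
    admissible G0 G1 G U u /\ e = L2sq G U u]).

Definition H_dist (G0 G1 : psdMeasure R d) : \bar R :=
  sqrte (ereal_inf [set e | exists G U u,
    [/\ admissible G0 G1 G U u, u = cst 0 & e = L2sq G U u]]).

End KantorovichBures.

(* Constant-speed minimizing geodesics; only the values on [0, 1] matter. *)
Definition geodesic (R : realType) (X : Type) (dist : X -> X -> \bar R)
    (c : R -> X) : Prop :=
  exists L : R, forall s t : R, 0 <= s <= 1 -> 0 <= t <= 1 ->
    dist (c s) (c t) = (L * `|t - s|)%:E.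

(* Main.v *)
(** Write P1 = T P0 T with T positive definite, and S = T - 1.  The path
    (1 + t S) P0 (1 + t S) from P0 to P1 has constant squared speed
    4 tr (S P0 S).  A calibration shows that it is optimal: the symmetric field
    Phi_t = 4 S (1 + t S)^-1 solves Phi' = - Phi^2 / 4, so for a path G with
    2 G' = G U + U G Young's inequality gives
      (tr (Phi G))' = tr (Phi G U) - tr (Phi G Phi) / 4 <= tr (U G U),
    and the increment of tr (Phi G) over [0, 1] is 4 tr (S P0 S).  The field
    Phi_t is also a test field for the continuity equation of matrix measures;
    being constant in space it has no divergence, which eliminates the
    transport velocity, and the same lower bound holds for d_KB.  The optimal
    path times lambda is admissible with u = 0, so all three infima agree. *)
Require Import Defs.
From mathcomp Require Import all_boot all_order all_algebra.
From mathcomp Require Import all_classical all_reals all_analysis.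
From mathcomp Require Import spectral complex measurable_realfun ring lra.
Import Order.TTheory GRing.Theory Num.Theory.
Import numFieldNormedType.Exports.
Local Open Scope classical_set_scope.
Local Open Scope ring_scope.
Set Implicit Arguments.
Unset Strict Implicit.
Unset Printing Implicit Defensive.

(** * Positive matrices *)

(** Two obstacles shape the proof. A competitor for the Riemannian distance is only piecewise C^1
    and is measured by its length, whereas the calibration bounds an action over unit time: each
    piece is reparametrized, and the pieces are joined by the triangle inequality for the square
    root of the cost. A competitor for [KB_dist] comes with densities [density (G r)] chosen
    separately for each time [r], so neither the action [int_sq (G r)] nor the pairing
    [int_pair (G r)] is known to be measurable in [r]; the integration in time therefore uses lower
    integrals and asks measurability of the calibration term alone.

    Young's inequality is the expansion of the square of [U - Phi / 2] weighted by [G], with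
    equality for [U = Phi / 2], the tangent field of the optimal path. As [S] commutes with
    [(1 + t S)^-1], the field [Phi] is symmetric and its equation is checked as for scalars. *)

Section InnerProduct.
Context {R : realType}.
Implicit Types m n d : nat.

Lemma innerC m n (A B : 'M[R]_(m, n)) : inner A B = inner B A.
Proof. by rewrite /inner -mxtrace_tr trmx_mul trmxK. Qed.

Lemma innerDl m n (A B C : 'M[R]_(m, n)) : inner (A + B) C = inner A C + inner B C.
Proof. by rewrite /inner mulmxDl mxtraceD. Qed.

Lemma innerZl m n a (A B : 'M[R]_(m, n)) : inner (a *: A) B = a * inner A B.
Proof. by rewrite /inner -scalemxAl mxtraceZ. Qed.

Lemma innerNl m n (A B : 'M[R]_(m, n)) : inner (- A) B = - inner A B.
Proof. by rewrite -scaleN1r innerZl mulN1r. Qed.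

Lemma innerBl m n (A B C : 'M[R]_(m, n)) : inner (A - B) C = inner A C - inner B C.
Proof. by rewrite innerDl innerNl. Qed.

Lemma innerDr m n (A B C : 'M[R]_(m, n)) : inner A (B + C) = inner A B + inner A C.
Proof. by rewrite !(innerC A) innerDl. Qed.

Lemma innerZr m n a (A B : 'M[R]_(m, n)) : inner A (a *: B) = a * inner A B.
Proof. by rewrite !(innerC A) innerZl. Qed.

Lemma innerNr m n (A B : 'M[R]_(m, n)) : inner A (- B) = - inner A B.
Proof. by rewrite !(innerC A) innerNl. Qed.

Lemma innerBr m n (A B C : 'M[R]_(m, n)) : inner A (B - C) = inner A B - inner A C.
Proof. by rewrite innerDr innerNr. Qed.

Lemma inner0l m n (A : 'M[R]_(m, n)) : inner 0 A = 0.
Proof. by rewrite /inner mul0mx mxtrace0. Qed.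

Lemma innerE m n (A B : 'M[R]_(m, n)) : inner A B = \sum_i \sum_j A i j * B i j.
Proof.
by apply: eq_bigr => i _; rewrite mxE; apply: eq_bigr => j _; rewrite !mxE.
Qed.

Lemma inner_mull m n p (P : 'M[R]_(m, n)) (X : 'M[R]_(n, p)) (Y : 'M[R]_(m, p)) :
  inner (P *m X) Y = inner X (P^T *m Y).
Proof. by rewrite /inner trmx_mul trmxK mulmxA [RHS]mxtrace_mulC mulmxA. Qed.

Lemma inner_mulr m n p (X : 'M[R]_(m, n)) (P : 'M[R]_(n, p)) (Y : 'M[R]_(m, p)) :
  inner (X *m P) Y = inner X (Y *m P^T).
Proof. by rewrite /inner trmx_mul trmxK mulmxA. Qed.

Lemma inner_ge0 m n (A : 'M[R]_(m, n)) : 0 <= inner A A.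
Proof. by rewrite innerE; do 2!apply: sumr_ge0 => ? _; rewrite -expr2 sqr_ge0. Qed.

Lemma inner_eq0 m n (A : 'M[R]_(m, n)) : inner A A = 0 -> A = 0.
Proof.
rewrite innerE => A0; apply/matrixP => i j; rewrite mxE; apply/eqP.
have p0 i' j' : 0 <= A i' j' * A i' j' by rewrite -expr2 sqr_ge0.
have /psumr_eq0P : \sum_i \sum_j A i j * A i j = 0 by [].
move=> /(_ (fun i' _ => sumr_ge0 _ (fun j' _ => p0 i' j'))) /(_ i isT) Ai.
move/psumr_eq0P : Ai => /(_ (fun j' _ => p0 i j')) /(_ j isT) /eqP.
by rewrite mulf_eq0 orbb.
Qed.

(** With [a] and [b] the norms of [X] and [Y], the square of the norm of [b *: X - a *: Y] is
    [2 a b (a b - inner X Y)]. Dividing by [a b] is the reason for treating zero matrices apart. *)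
Lemma inner_CauchySchwarz m n (X Y : 'M[R]_(m, n)) :
  inner X Y <= Num.sqrt (inner X X) * Num.sqrt (inner Y Y).
Proof.
set a := Num.sqrt (inner X X); set b := Num.sqrt (inner Y Y).
have a2 : a ^+ 2 = inner X X by rewrite sqr_sqrtr ?inner_ge0.
have b2 : b ^+ 2 = inner Y Y by rewrite sqr_sqrtr ?inner_ge0.
have a0 : 0 <= a by exact: sqrtr_ge0.
have b0 : 0 <= b by exact: sqrtr_ge0.
have [X0|X0] := eqVneq X 0; first by rewrite X0 inner0l mulr_ge0.
have [Y0|Y0] := eqVneq Y 0; first by rewrite Y0 innerC inner0l mulr_ge0.
have ap : 0 < a.
  rewrite lt_neqAle a0 andbT; apply: contraNneq X0 => a_0.
  by apply/eqP/inner_eq0; rewrite -a2 -a_0 expr0n.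
have bp : 0 < b.
  rewrite lt_neqAle b0 andbT; apply: contraNneq Y0 => b_0.
  by apply/eqP/inner_eq0; rewrite -b2 -b_0 expr0n.
have := inner_ge0 (b *: X - a *: Y).
rewrite innerBl !innerBr !innerZl !innerZr (innerC Y X) -a2 -b2 => h.
rewrite -subr_ge0 -(pmulr_rge0 _ (mulr_gt0 ap bp)) -(pmulr_rge0 _ (ltr0Sn R 1)).
by apply: le_trans h _; rewrite le_eqVlt; apply/orP; left; apply/eqP; ring.
Qed.

Lemma inner_norm_triangle m n (X Y : 'M[R]_(m, n)) :
  Num.sqrt (inner (X + Y) (X + Y)) <=
  Num.sqrt (inner X X) + Num.sqrt (inner Y Y).
Proof.
rewrite -(ler_pXn2r (ltn0Sn 1)) ?nnegrE ?addr_ge0 ?sqrtr_ge0//.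
rewrite sqrrD !sqr_sqrtr ?inner_ge0// innerDl !innerDr (innerC Y X).
have := inner_CauchySchwarz X Y; lra.
Qed.

(** [psdmx] tests column vectors only; the splitting into columns carries positivity over to matrix
    fields. *)
Lemma inner_colE d n (P : 'M[R]_d) (X : 'M[R]_(d, n)) :
  inner (P *m X) X = \sum_j inner (P *m col j X) (col j X).
Proof.
rewrite innerE exchange_big /=; apply: eq_bigr => j _.
rewrite innerE; apply: eq_bigr => i _.
by rewrite big_ord1 colE mulmxA -!colE !mxE.
Qed.

End InnerProduct.

Section PositiveMatrices.
Context {R : realType}.
Implicit Types m n d : nat.

Lemma psd_inner_ge0 d n (P : 'M[R]_d) (X : 'M[R]_(d, n)) :
  psdmx P -> 0 <= inner (P *m X) X.
Proof. by move=> [_ P0]; rewrite inner_colE; apply: sumr_ge0 => j _; exact: P0. Qed.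

Lemma pd_psd d (P : 'M[R]_d) : pdmx P -> psdmx P.
Proof. by move=> /(psdmxZ ler01); rewrite scale1r. Qed.

Lemma pd_inner_gt0 d n (P : 'M[R]_d) (X : 'M[R]_(d, n)) :
  pdmx P -> X != 0 -> 0 < inner (P *m X) X.
Proof.
move=> Ppd X0; rewrite lt_neqAle psd_inner_ge0 ?andbT; last exact: pd_psd.
apply: contraNneq X0 => /esym; rewrite inner_colE => /psumr_eq0P.
have p0 j : true -> 0 <= inner (P *m col j X) (col j X).
  by move=> _; apply/psd_inner_ge0/pd_psd.
move=> /(_ p0) e; apply/eqP/matrixP => i j; rewrite mxE.
have [/matrixP/(_ i 0)|c0] := eqVneq (col j X) 0; first by rewrite !mxE.
by have := Ppd.2 _ c0; rewrite e// ltxx.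
Qed.

Lemma psd_inner_tr_ge0 d n (P : 'M[R]_d) (X : 'M[R]_(n, d)) :
  psdmx P -> 0 <= inner (X *m P) X.
Proof.
move=> Ppsd; have := psd_inner_ge0 X^T Ppsd.
by rewrite /inner trmxK mxtrace_mulC mulmxA.
Qed.

Lemma pd_unitmx d (P : 'M[R]_d) : pdmx P -> P \in unitmx.
Proof.
move=> [Psym Ppos]; rewrite unitmxE unitfE; apply/det0P => -[v v0 vP].
have v1 : v^T != 0 by rewrite trmx_eq0.
have := Ppos _ v1; rewrite -[P]Psym -trmx_mul vP trmx0 inner0l.
by rewrite ltxx.
Qed.

Lemma pd1 d : pdmx (1%:M : 'M[R]_d).
Proof.
split; first by rewrite trmx1.
move=> v v0; rewrite mul1mx lt_neqAle inner_ge0 andbT eq_sym.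
by apply: contraNneq v0 => /inner_eq0 ->.
Qed.

Lemma pdD d (P Q : 'M[R]_d) : pdmx P -> psdmx Q -> pdmx (P + Q).
Proof.
move=> [Ps Pp] [Qs Qp]; split; first by rewrite linearD /= Ps Qs.
by move=> v v0; rewrite mulmxDl innerDl ltr_pwDl// Pp.
Qed.

Lemma pdZ d a (P : 'M[R]_d) : 0 < a -> pdmx P -> pdmx (a *: P).
Proof.
move=> a0 [Ps Pp]; split; first by rewrite linearZ /= Ps.
by move=> v v0; rewrite -scalemxAl innerZl mulr_gt0// Pp.
Qed.

Lemma pd_convex d t (P Q : 'M[R]_d) : 0 <= t <= 1 ->
  pdmx P -> pdmx Q -> pdmx ((1 - t) *: P + t *: Q).
Proof.
move=> /andP[t0 t1] Ppd Qpd; have [->|t1'] := eqVneq t 1.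
  by rewrite subrr scale0r add0r scale1r.
apply: pdD; last exact: psdmxZ.
by apply: pdZ => //; rewrite subr_gt0 lt_neqAle t1'.
Qed.

Lemma pd_conj d (P T : 'M[R]_d) : pdmx P -> T \in unitmx -> pdmx (T^T *m P *m T).
Proof.
move=> [Ps Pp] Tu; split; first by rewrite !trmx_mul trmxK Ps mulmxA.
move=> v v0; rewrite -!mulmxA inner_mull trmxK Pp//.
apply: contraNneq v0 => Tv; apply/eqP.
by rewrite -(mulKmx Tu v) Tv mulmx0.
Qed.

Lemma pd_conj_sym d (P T : 'M[R]_d) : pdmx P -> pdmx T -> pdmx (T *m P *m T).
Proof. by move=> Pp Tp; rewrite -{1}Tp.1; apply: pd_conj => //; exact: pd_unitmx. Qed.

Lemma pd_inv d (P : 'M[R]_d) : pdmx P -> pdmx (invmx P).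
Proof.
move=> Ppd; have Pu := pd_unitmx Ppd.
have Is : (invmx P)^T = invmx P by rewrite trmx_inv Ppd.1.
have := pd_conj Ppd (T := invmx P); rewrite unitmx_inv => /(_ Pu).
by rewrite Is mulVmx// mul1mx.
Qed.

(** Expand [inner (g *m W) W >= 0] for [W = U - V / 2]; the symmetry of [g] merges the two cross
    terms. *)
Lemma psd_Young d n (g : 'M[R]_d) (U V : 'M[R]_(d, n)) : psdmx g ->
  inner (g *m U) V <= inner (g *m U) U + 4^-1 * inner (g *m V) V.
Proof.
move=> gp; have := psd_inner_ge0 (U - 2^-1 *: V) gp.
rewrite mulmxBr -scalemxAr innerBl !innerBr !innerZl !innerZr.
rewrite (_ : inner (g *m V) U = inner (g *m U) V); first lra.
by rewrite innerC [RHS]inner_mull gp.1.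
Qed.

End PositiveMatrices.

(** * Square roots and transport maps *)

Section SquareRoot.
Context {R : realType}.
Implicit Types d : nat.

(** Newton interpolation: a new node is served by a multiple of the product of the ['X - b%:P] over
    the earlier nodes, which vanishes at all of them. *)
Lemma interpolation_exists (s : seq R) (f : R -> R) :
  exists p : {poly R}, {in s, forall x, p.[x] = f x}.
Proof.
elim: s => [|a s [p ps]]; first by exists 0.
have [as_|as_] := boolP (a \in s).
  by exists p => x; rewrite inE => /orP[/eqP ->|]; exact: ps.
pose q := \prod_(b <- s) ('X - b%:P).
have qa : q.[a] != 0 by rewrite -rootE root_prod_XsubC.
exists (p + ((f a - p.[a]) / q.[a]) *: q) => x; rewrite inE => /orP[/eqP ->|xs].
  by rewrite hornerD hornerZ divfK// addrC subrK.
have /eqP qx : q.[x] == 0 by rewrite -rootE root_prod_XsubC.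
by rewrite hornerD hornerZ qx mulr0 addr0 ps.
Qed.

Let C := R[i].
Let toC : {rmorphism R -> C} := real_complex R.

Lemma psd_spectral d (A : 'M[R]_d.+1) : psdmx A ->
  exists (P : 'M[C]_d.+1) (r : 'rV[R]_d.+1), [/\ P \in unitmx,
    map_mx toC A = invmx P *m diag_mx (map_mx toC r) *m P &
    forall j, 0 <= r 0 j].
Proof.
move=> [As Ap]; set B := map_mx toC A.
have Bs : B^T = B by rewrite /B map_trmx As.
have Br : B \is a mxOver Num.real.
  apply/mxOverP => i j; rewrite mxE; apply/complex_realP; first by exists (A i j).
have Bh : B \is hermsymmx.
  apply: realsym_hermsym => //; apply/is_hermitianmxP.
  by rewrite expr0 scale1r map_mx_id// Bs.
have /orthomx_spectralP Bdec := hermitian_normalmx Bh.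
have Pu := spectral_unit B.
have /mxOverP Dr := hermitian_spectral_diag_real Bh.
have [r De] : exists r : 'rV[R]_d.+1, map_mx toC r = spectral_diag B.
  exists (\row_j complex.Re (spectral_diag B 0 j)).
  by apply/rowP => j; rewrite !mxE; exact: (RRe_real (Dr _ _)).
exists (spectralmx B), r; rewrite De; split; [exact: Pu|exact: Bdec|move=> j].
have rj : toC (r 0 j) = spectral_diag B 0 j by rewrite -De mxE.
(* The determinant vanishes over [C], hence over [R]. The eigenvalue thus has a real eigenvector, on
   which the positivity of [A], stated for real vectors, gives its sign. *)
have : \det (A - (r 0 j)%:M) = 0.
  apply: (fmorph_inj toC); rewrite rmorph0 -det_map_mx map_mxB map_scalar_mx rj.
  rewrite -/B {1}Bdec.
  rewrite (_ : _ - _ = invmx (spectralmx B) *m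
    (diag_mx (spectral_diag B) - (spectral_diag B 0 j)%:M) *m spectralmx B).
    rewrite !det_mulmx; apply/eqP; rewrite !mulf_eq0; apply/orP; left.
    apply/orP; right; rewrite -diag_const_mx -linearB /= det_diag.
    by rewrite (bigD1 j)//= !mxE subrr mul0r.
  by rewrite mulmxBr mulmxBl mul_mx_scalar -scalemxAl mulVmx// scalemx1.
move/eqP/det0P => [v v0]; rewrite mulmxBr mul_mx_scalar => /subr0_eq vA.
have v1 : v^T != 0 by rewrite trmx_eq0.
have := Ap v^T; rewrite -[A]As -trmx_mul vA linearZ /= innerZl.
by rewrite pmulr_lge0//; have := (pd1 _).2 _ v1; rewrite mul1mx.
Qed.

(* The spectral theorem is over R[i], but the root is a polynomial in A with real
   coefficients; as the square of a symmetric fourth root it is nonnegative. *)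
Lemma psd_sqrt d (A : 'M[R]_d) : psdmx A ->
  exists B : 'M[R]_d, psdmx B /\ B *m B = A.
Proof.
case: d A => [A _|d A Apsd].
  exists 0; split; first exact: psdmx0.
  by rewrite mulmx0; apply/matrixP => -[].
have [P [r [Pu PA r0]]] := psd_spectral Apsd.
have [p pr] := interpolation_exists [seq r 0 j | j <- enum 'I_d.+1]
  (fun x => Num.sqrt (Num.sqrt x)).
pose Q := horner_mx A p.
have Qs : Q^T = Q.
  rewrite /Q; elim/poly_ind: p {pr Q} => [|p c IH].
    by rewrite rmorph0 trmx0.
  rewrite rmorphD rmorphM /= horner_mx_C horner_mx_X linearD /= tr_scalar_mx.
  rewrite -[in LHS]/(mulmx _ _) trmx_mul IH Apsd.1.
  by congr (_ + _); have := rmorphM (horner_mx A) p 'X; rewrite mulrC rmorphM /= horner_mx_X.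
have Q4 : Q *m Q *m (Q *m Q) = A.
  have -> : Q *m Q *m (Q *m Q) = horner_mx A (p * p * (p * p)).
    by rewrite !rmorphM.
  apply: (map_mx_inj (f := toC)).
  rewrite map_horner_mx PA horner_mx_uconjC// horner_mx_diag.
  congr (_ *m diag_mx _ *m _); apply/rowP => j; rewrite !mxE horner_map /=.
  rewrite !hornerM pr; last by apply/mapP; exists j; rewrite ?mem_enum.
  by rewrite -expr2 -expr2 !sqr_sqrtr ?sqrtr_ge0.
exists (Q *m Q); split=> //; split; first by rewrite trmx_mul Qs.
by move=> v; rewrite -mulmxA inner_mull Qs inner_ge0.
Qed.

(** A root [D] of the root [B] gives [inner (B *m v) v] as the squared norm of [D *m v]; if that
    vanished, so would [A *m v = D D D D v]. *)
Lemma pd_sqrt d (A : 'M[R]_d) : pdmx A ->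
  exists B : 'M[R]_d, pdmx B /\ B *m B = A.
Proof.
move=> Apd; have [B [Bpsd BB]] := psd_sqrt (pd_psd Apd).
exists B; split=> //; split=> [|v v0]; first exact: Bpsd.1.
have [D [Dpsd DD]] := psd_sqrt Bpsd.
rewrite -DD -mulmxA inner_mull Dpsd.1 lt_neqAle inner_ge0 andbT eq_sym.
apply/eqP => /inner_eq0 Dv.
by have := Apd.2 _ v0; rewrite -BB -DD -!mulmxA Dv !mulmx0 inner0l ltxx.
Qed.

(** With [Q] the root of [P0], the solution is [Q^-1 (Q P1 Q)^(1/2) Q^-1], the geometric mean of
    [P0^-1] and [P1]. *)
Lemma transport_exists d (P0 P1 : 'M[R]_d) : pdmx P0 -> pdmx P1 ->
  exists T : 'M[R]_d, pdmx T /\ T *m P0 *m T = P1.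
Proof.
move=> /pd_sqrt[Q [Qpd <-]] P1pd.
have [N [Npd NN]] := pd_sqrt (pd_conj_sym P1pd Qpd).
have Qu := pd_unitmx Qpd.
exists (invmx Q *m N *m invmx Q); split.
  by apply: pd_conj_sym => //; exact: pd_inv.
rewrite !mulmxA mulmxKV// -!mulmxA mulKVmx// !mulmxA -(mulmxA _ N N) NN.
by rewrite !mulmxA mulVmx// mul1mx mulmxK.
Qed.

End SquareRoot.

(** * Matrix calculus *)

Section MatrixLimits.
Context {R : realType} {T : Type} {F : set_system T} {FF : Filter F}.

Lemma cvg_mx m n (M : T -> 'M[R]_(m, n)) (L : 'M[R]_(m, n)) :
  (forall i j, (fun x => M x i j) @ F --> L i j) -> M @ F --> L.
Proof.
move=> ML; apply/cvgrPdist_le => /= e e0; near=> x.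
rewrite /Num.Def.normr/= mx_normrE (bigmax_le _ (ltW e0))//= => i _.
rewrite !mxE; move: i; near: x; apply: filter_forall => /= i.
exact: ((cvgrPdist_le _ _).1 (ML i.1 i.2)).
Unshelve. all: by end_near. Qed.

Lemma cvg_mx_entry m n (M : T -> 'M[R]_(m, n)) (L : 'M[R]_(m, n)) i j :
  M @ F --> L -> (fun x => M x i j) @ F --> L i j.
Proof. by move=> ML; exact: (cvg_comp _ _ ML (@coord_continuous R m n i j L)). Qed.

Lemma cvg_mulmx m n p (M : T -> 'M[R]_(m, n)) (N : T -> 'M[R]_(n, p))
    (L : 'M[R]_(m, n)) (K : 'M[R]_(n, p)) :
  M @ F --> L -> N @ F --> K -> (fun x => M x *m N x) @ F --> L *m K.
Proof.
move=> ML NK; apply: cvg_mx => i j; rewrite mxE.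
under eq_fun do rewrite mxE.
apply: cvg_big => [|k _]; first exact: add_continuous.
by apply: cvgM; exact: cvg_mx_entry.
Qed.

Lemma cvg_inner m n (M N : T -> 'M[R]_(m, n)) (L K : 'M[R]_(m, n)) :
  M @ F --> L -> N @ F --> K -> (fun x => inner (M x) (N x)) @ F --> inner L K.
Proof.
move=> ML NK; rewrite innerE; under eq_fun do rewrite innerE.
apply: cvg_big => [|i _]; first exact: add_continuous.
apply: cvg_big => [|j _]; first exact: add_continuous.
by apply: cvgM; exact: cvg_mx_entry.
Qed.

Lemma cvg_det n (M : T -> 'M[R]_n) (L : 'M[R]_n) :
  M @ F --> L -> (fun x => \det (M x)) @ F --> \det L.
Proof.
move=> ML; apply: cvg_big => [|s _]; first exact: add_continuous.
apply: cvgM; first exact: cvg_cst.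
apply: cvg_big => [|i _]; first exact: mul_continuous.
exact: cvg_mx_entry.
Qed.

(** Cramer's formula is continuous in the entries. It describes [invmx] on units only, and near the
    limit all matrices are units because the determinant stays away from 0. *)
Lemma cvg_invmx n (M : T -> 'M[R]_n) (L : 'M[R]_n) : L \in unitmx ->
  M @ F --> L -> (fun x => invmx (M x)) @ F --> invmx L.
Proof.
move=> Lu ML; have dL : \det L != 0 by rewrite -unitfE -unitmxE.
have Mu : \forall x \near F, M x \in unitmx.
  apply: filterS (cvgr_neq0 _ (cvg_det ML) dL) => x.
  by rewrite unitmxE unitfE.
apply: (@cvg_trans _ ((fun x => (\det (M x))^-1 *: \adj (M x)) @ F)).
  apply: near_eq_cvg; apply: filterS Mu => x Mx.
  by rewrite /invmx Mx.
rewrite /invmx Lu; apply: cvgZ; first by apply: cvgV => //; exact: cvg_det.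
apply: cvg_mx => i j; rewrite mxE; under eq_fun do rewrite mxE.
rewrite /cofactor; apply: cvgM; first exact: cvg_cst.
apply: cvg_det; apply: cvg_mx => k l.
by rewrite !mxE; under eq_fun do rewrite !mxE; exact: cvg_mx_entry.
Qed.

End MatrixLimits.

Section MatrixDerivatives.
Context {R : realType} {V : normedModType R}.
Implicit Types (t v : V).

Lemma is_derive_mx m n (M : V -> 'M[R]_(m, n)) t v (D : 'M[R]_(m, n)) :
  (forall i j, is_derive t v (fun x => M x i j) (D i j)) -> is_derive t v M D.
Proof.
move=> MD; have dM : derivable M t v by apply/derivable_mxP => i j; case: (MD i j).
apply: DeriveDef => //; rewrite derive_mx//; apply/matrixP => i j.
by rewrite mxE; case: (MD i j).
Qed.

Lemma is_derive_mx_entry m n (M : V -> 'M[R]_(m, n)) t v (D : 'M[R]_(m, n)) i j :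
  is_derive t v M D -> is_derive t v (fun x => M x i j) (D i j).
Proof.
move=> [dM <-]; apply: DeriveDef; first by move/derivable_mxP : dM; exact.
by rewrite derive_mx// mxE.
Qed.

Lemma is_derive_mulmx m n p (M : V -> 'M[R]_(m, n)) (N : V -> 'M[R]_(n, p)) t v M' N' :
  is_derive t v M M' -> is_derive t v N N' ->
  is_derive t v (fun x => M x *m N x) (M' *m N t + M t *m N').
Proof.
move=> dM dN; apply: is_derive_mx => i j.
rewrite (_ : (fun x => _) = \sum_k (fun x => M x i k * N x k j)); last first.
  by apply/funext => x; rewrite mxE fct_sumE.
rewrite !mxE -big_split /=.
apply: is_derive_eq.
  apply: is_derive_sum => k.
  apply: (is_deriveM (is_derive_mx_entry i k dM) (is_derive_mx_entry k j dN)).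
by apply: eq_bigr => k _ /=; rewrite addrC /GRing.scale/= (mulrC (M' _ _)).
Qed.

Lemma is_derive_inner m n (M N : V -> 'M[R]_(m, n)) t v M' N' :
  is_derive t v M M' -> is_derive t v N N' ->
  is_derive t v (fun x => inner (M x) (N x)) (inner M' (N t) + inner (M t) N').
Proof.
move=> dM dN.
rewrite (_ : (fun x => _) = \sum_i \sum_j (fun x => M x i j * N x i j)); last first.
  apply/funext => x; rewrite innerE fct_sumE.
  by apply: eq_bigr => i _; rewrite fct_sumE.
rewrite !innerE -big_split /=.
apply: is_derive_eq.
  apply: is_derive_sum => i; apply: is_derive_sum => j.
  apply: (is_deriveM (is_derive_mx_entry i j dM) (is_derive_mx_entry i j dN)).
apply: eq_bigr => i _ /=; rewrite -big_split /=; apply: eq_bigr => j _.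
by rewrite addrC /GRing.scale/= (mulrC (M' _ _)).
Qed.

(** Derivability along [v] yields continuity along that line only, which is all that the difference
    quotients of an inverse require. *)
Lemma derivable_cvg_line (W : normedModType R) (f : V -> W) t v :
  derivable f t v -> f (h *: v + t) @[h --> 0^'] --> f t.
Proof.
move=> dft.
have h0 : h @[h --> (0 : R)^'] --> (0 : R) by exact: nbhs_dnbhs.
apply: (@cvg_trans _ ((fun h => h *: (h^-1 *: (f (h *: v + t) - f t)) + f t) @ 0^')).
  apply: near_eq_cvg.
  near=> h => /=; rewrite scalerA mulfV ?scale1r ?subrK//.
  by near: h; exact: nbhs_dnbhs_neq.
have -> : nbhs (f t) = nbhs (0 *: 'D_v f t + f t) by rewrite scale0r add0r.
by apply: cvgD; [apply: cvgZ; [exact: h0|exact: dft]|exact: cvg_cst].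
Unshelve. all: by end_near. Qed.

(* The difference quotients satisfy
   (N^-1 - M^-1) / h = - N^-1 ((N - M) / h) M^-1. *)
Lemma is_derive_invmx n (M : V -> 'M[R]_n) t v M' :
  M t \in unitmx -> is_derive t v M M' ->
  is_derive t v (fun x => invmx (M x)) (- (invmx (M t) *m M' *m invmx (M t))).
Proof.
move=> Mu [dM <-].
have Mc := derivable_cvg_line dM.
have Muh : \forall h \near 0^', M (h *: v + t) \in unitmx.
  have dL : \det (M t) != 0 by rewrite -unitfE -unitmxE.
  apply: filterS (cvgr_neq0 _ (cvg_det Mc) dL) => x.
  by rewrite unitmxE unitfE.
suff : h^-1 *: (invmx (M (h *: v + t)) - invmx (M t)) @[h --> 0^'] -->
    - (invmx (M t) *m 'D_v M t *m invmx (M t)).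
  by move=> l; apply: DeriveDef; [apply/cvg_ex; eexists; exact: l|exact: cvg_lim l].
apply: (@cvg_trans _ ((fun h => - (invmx (M (h *: v + t)) *m
    (h^-1 *: (M (h *: v + t) - M t)) *m invmx (M t))) @ 0^')); last first.
  apply: cvgN; apply: cvg_mulmx; last exact: cvg_cst.
  by apply: cvg_mulmx; [exact: cvg_invmx|exact: dM].
apply: near_eq_cvg; near=> h => /=.
have Nu : M (h *: v + t) \in unitmx by near: h.
rewrite -scalemxAr -scalemxAl -scalerN; congr (_ *: _).
by rewrite mulmxBr mulVmx// mulmxBl mul1mx -mulmxA mulmxV// mulmx1 opprB.
Unshelve. all: by end_near. Qed.

End MatrixDerivatives.

(** * The Bures cost and its calibration *)

Section BuresCost.
Context {R : realType}.
Implicit Types d : nat.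

(** The linear optimal transport map between centred Gaussian measures with covariances [P0] and
    [P1]. *)
Definition transport d (P0 P1 : 'M[R]_d) : 'M[R]_d :=
  xget 1%:M [set T | pdmx T /\ T *m P0 *m T = P1].

Lemma transportP d (P0 P1 : 'M[R]_d) : pdmx P0 -> pdmx P1 ->
  pdmx (transport P0 P1) /\ transport P0 P1 *m P0 *m transport P0 P1 = P1.
Proof.
by move=> P0p P1p; have [T TP] := transport_exists P0p P1p;
exact: (@xgetI _ 1%:M [set T | pdmx T /\ T *m P0 *m T = P1] T).
Qed.

(* The squared Bures distance for the normalization 2 Xi = P U + U P of the
   metric; that of optimal transport is a quarter of it. *)
Definition bures_cost d (P0 P1 : 'M[R]_d) : R :=
  4 * inner (P0 *m (transport P0 P1 - 1%:M)) (transport P0 P1 - 1%:M).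

Lemma bures_cost_ge0 d (P0 P1 : 'M[R]_d) : psdmx P0 -> 0 <= bures_cost P0 P1.
Proof. by move=> ?; rewrite mulr_ge0// psd_inner_ge0. Qed.

(** The square of [T X - Z] weighted by [T^-1] is nonnegative, and [inner (invmx T *m Z) Z] and
    [inner X (T *m X)] both equal [\tr (P0 *m T)]. Hence [inner X Z <= \tr (P0 *m T)], with equality
    for [Z = T *m X]: the cost is the least squared distance between factors of the two matrices. *)
Lemma bures_cost_frame d (P0 P1 X Z : 'M[R]_d) : pdmx P0 -> pdmx P1 ->
  X *m X^T = P0 -> Z *m Z^T = P1 ->
  bures_cost P0 P1 <= 4 * inner (Z - X) (Z - X).
Proof.
move=> P0p P1p XP0 ZP1; have [Tp TP] := transportP P0p P1p.
rewrite /bures_cost; set T := transport P0 P1 in Tp TP *.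
rewrite ler_pM2l//.
have := psd_inner_ge0 (T *m X - Z) (pd_psd (pd_inv Tp)).
have Tu := pd_unitmx Tp.
have e1 : inner X (T *m X) = \tr (P0 *m T).
  by rewrite /inner trmx_mul mulmxA XP0 Tp.1.
have e2 : inner (invmx T *m Z) Z = \tr (P0 *m T).
  by rewrite /inner -mulmxA ZP1 -TP -mulmxA mulKmx.
have e3 : inner (invmx T *m Z) (T *m X) = inner Z X.
  by rewrite inner_mull trmx_inv Tp.1 mulKmx.
have e4 : inner X X = \tr P0 by rewrite /inner XP0.
have e5 : inner Z Z = \tr (P0 *m T *m T).
  by rewrite /inner ZP1 -TP -mulmxA mxtrace_mulC.
rewrite !mulmxBr mulKmx// mulmx1 !innerBl !innerBr e1 e2 e3 e4 e5 (innerC X Z).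
have innerT (A : 'M[R]_d) : inner A T = \tr (A *m T) by rewrite /inner Tp.1.
have inner1 (A : 'M[R]_d) : inner A 1%:M = \tr A by rewrite /inner trmx1 mulmx1.
rewrite !innerT !inner1; lra.
Qed.

(* The factors X, T X and T' T X of P0, P1 and P2 (in the sense P = X X^T) reduce
   this to the triangle inequality for the Hilbert-Schmidt norm. *)
Lemma bures_cost_triangle d (P0 P1 P2 : 'M[R]_d) :
  pdmx P0 -> pdmx P1 -> pdmx P2 ->
  Num.sqrt (bures_cost P0 P2) <=
  Num.sqrt (bures_cost P0 P1) + Num.sqrt (bures_cost P1 P2).
Proof.
move=> P0p P1p P2p; have [X [Xp XX]] := pd_sqrt P0p.
have [Tp TP] := transportP P0p P1p; have [T'p TP'] := transportP P1p P2p.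
set T := transport P0 P1 in Tp TP; set T' := transport P1 P2 in T'p TP'.
have s4 : Num.sqrt 4 = 2 :> R.
  by rewrite (_ : 4 = 2 ^+ 2) ?sqrtr_sqr ?ger0_norm//; ring.
have e d' (P Q Y : 'M[R]_d') : P^T = P -> Q^T = Q -> Y *m Y^T = P ->
    inner (P *m Q) Q = inner (Q *m Y) (Q *m Y).
  move=> Ps Qs YP; rewrite /inner trmx_mul !mulmxA -(mulmxA Q) YP Qs.
  by rewrite -[in RHS]mulmxA [RHS]mxtrace_mulC.
have sym1 (Q : 'M[R]_d) : Q^T = Q -> (Q - 1%:M)^T = Q - 1%:M.
  by move=> Qs; rewrite linearB /= Qs trmx1.
pose Y := T *m X; pose Z := T' *m Y.
have XP0 : X *m X^T = P0 by rewrite Xp.1.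
have YP1 : Y *m Y^T = P1.
  by rewrite /Y trmx_mul mulmxA -(mulmxA T) XP0 Tp.1.
have ZP2 : Z *m Z^T = P2.
  by rewrite /Z trmx_mul mulmxA -(mulmxA T') YP1 T'p.1.
have -> : bures_cost P0 P1 = 4 * inner (Y - X) (Y - X).
  by rewrite /bures_cost -/T (e _ _ _ X) ?sym1 ?Tp.1 ?P0p.1// mulmxBl mul1mx.
have -> : bures_cost P1 P2 = 4 * inner (Z - Y) (Z - Y).
  by rewrite /bures_cost -/T' (e _ _ _ Y) ?sym1 ?T'p.1 ?P1p.1// mulmxBl mul1mx.
apply: (le_trans (ler_wsqrtr (bures_cost_frame P0p P2p XP0 ZP2))).
rewrite !sqrtrM// s4 -mulrDr ler_pM2l// [leRHS]addrC.
by rewrite (_ : Z - X = (Z - Y) + (Y - X)) ?inner_norm_triangle// addrA subrK.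
Qed.

End BuresCost.

(** * The solution of the Hamilton-Jacobi equation *)

Section Calibration.
Context {R : realType} {d : nat}.
Variable T : 'M[R]_d.
Hypothesis Tp : pdmx T.

Definition interp_mx (t : R) : 'M[R]_d := 1%:M + t *: (T - 1%:M).

Lemma interp_mx0 : interp_mx 0 = 1%:M.
Proof. by rewrite /interp_mx scale0r addr0. Qed.

Lemma interp_mx1 : interp_mx 1 = T.
Proof. by rewrite /interp_mx scale1r addrC subrK. Qed.

Lemma interp_mx_pd t : 0 <= t <= 1 -> pdmx (interp_mx t).
Proof.
move=> t01; rewrite (_ : interp_mx t = (1 - t) *: 1%:M + t *: T).
  exact: pd_convex (@pd1 R d) Tp.
by rewrite /interp_mx scalerBr scalerBl scale1r addrA addrAC.
Qed.

Lemma interp_mx_sym t : (interp_mx t)^T = interp_mx t.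
Proof. by rewrite /interp_mx linearD linearZ linearB /= trmx1 Tp.1. Qed.

Lemma interp_mxC t : (T - 1%:M) *m interp_mx t = interp_mx t *m (T - 1%:M).
Proof.
by rewrite /interp_mx mulmxDr mulmxDl mulmx1 mul1mx -scalemxAl -scalemxAr.
Qed.

Lemma interp_mxVC t :
  (T - 1%:M) *m invmx (interp_mx t) = invmx (interp_mx t) *m (T - 1%:M).
Proof.
(* On a singular matrix [invmx] returns its argument, so the commutation, and with it the symmetry
   of [calib], holds for every real [t]. *)
have [u|u] := boolP (interp_mx t \in unitmx); last by rewrite invmx_out ?interp_mxC.
by apply: (can_inj (mulmxK u)); rewrite mulmxKV// -mulmxA interp_mxC mulKmx.
Qed.

(* The solution of the Hamilton-Jacobi equation Phi' = - Phi^2 / 4 along the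
   optimal path, on which the tangent U_Xi is Phi / 2. *)
Definition calib (t : R) : 'M[R]_d := 4 *: ((T - 1%:M) *m invmx (interp_mx t)).

Lemma calib_sym t : (calib t)^T = calib t.
Proof.
by rewrite /calib linearZ /= trmx_mul trmx_inv interp_mx_sym linearB /= trmx1 Tp.1 interp_mxVC.
Qed.

Lemma is_derive_interp_mx (t : R) : is_derive t 1 interp_mx (T - 1%:M).
Proof.
apply: is_derive_mx => i j.
rewrite (_ : (fun x => _) =
    cst ((1%:M : 'M[R]_d) i j) + (id * cst ((T - 1%:M) i j) : R -> R)).
  apply: (is_derive_eq (is_deriveD (is_derive_cst _ _ _)
    (is_deriveM (is_derive_id _ _) (is_derive_cst _ _ _)))).
  by rewrite /= add0r scaler0 add0r /GRing.scale /= mulr1.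
by apply/funext => x; rewrite !mxE.
Qed.

(** For [M = S (1 + t S)^-1] the derivative of the inverse gives [M' = - M^2]; the scaling
    [Phi = 4 M] turns this into [Phi' = - Phi^2 / 4]. *)
Lemma is_derive_calib (t : R) : interp_mx t \in unitmx ->
  is_derive t 1 calib (- 4^-1 *: (calib t *m calib t)).
Proof.
move=> u; have dV := is_derive_invmx u (is_derive_interp_mx t).
have dS : is_derive t 1 (fun=> T - 1%:M : 'M[R]_d) 0 by exact: is_derive_cst.
have := @is_deriveZ _ _ _ _ 4 _ _ _ (is_derive_mulmx dS dV).
rewrite mul0mx add0r mulmxN => h; apply: is_derive_eq h _.
rewrite /calib -scalemxAl -scalemxAr !scalerA scalerN -scaleNr !mulmxA.
by congr (_ *: _); field.
Qed.

(** The factor [T^-1] of [calib 1] cancels one outer [T] of [T P T]; what is left is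
    [4 tr (S P T) - 4 tr (S P)], with [S = T - 1]. *)
Lemma calib_boundary (P : 'M[R]_d) : P^T = P ->
  inner (calib 1) (T *m P *m T) - inner (calib 0) P =
  4 * inner (P *m (T - 1%:M)) (T - 1%:M).
Proof.
move=> Ps; rewrite /calib interp_mx0 interp_mx1 invmx1 mulmx1 !innerZl -mulrBr.
congr (4 * _); have Ss : (T - 1%:M)^T = T - 1%:M by rewrite linearB /= Tp.1 trmx1.
have := interp_mxVC 1; rewrite interp_mx1 => ->.
rewrite [X in X - _]inner_mull trmx_inv Tp.1 !mulmxA mulVmx ?pd_unitmx// mul1mx.
by rewrite -innerBr mulmxBr mulmx1 innerC.
Qed.

End Calibration.

(** * The Lyapunov equation and the Bures metric *)

Section Lyapunov.
Context {R : realType} {d : nat}.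
Implicit Types P Xi U : 'M[R]_d.

(** Pair the equation with [U]: both terms are nonnegative, and [inner (P *m U) U] is positive
    unless [U = 0]. *)
Lemma lyapunov_inj P U : pdmx P -> P *m U + U *m P = 0 -> U = 0.
Proof.
move=> Pp PU; apply/eqP/negP => /negP U0.
have := pd_inner_gt0 Pp U0; have := psd_inner_tr_ge0 U (pd_psd Pp).
have : inner (P *m U + U *m P) U = 0 by rewrite PU inner0l.
rewrite innerDl; lra.
Qed.

(** The map [U |-> P U + U P] on vectorized matrices. Being a matrix, it is inverted by [invmx],
    whose continuity is available. *)
Definition lyapunov_op P : 'M[R]_(d * d) := lin_mx (mulmx P) + lin_mx (mulmxr P).

Lemma lyapunov_opE P U : mxvec U *m lyapunov_op P = mxvec (P *m U + U *m P).
Proof. by rewrite mulmxDr !mul_vec_lin linearD. Qed.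

Lemma lyapunov_op_unit P : pdmx P -> lyapunov_op P \in unitmx.
Proof.
move=> Pp; rewrite unitmxE unitfE; apply/det0P => -[v v0].
rewrite -(vec_mxK v) lyapunov_opE => /(canRL mxvecK); rewrite linear0.
move/(lyapunov_inj Pp) => e; move: v0; rewrite -(vec_mxK v) e linear0.
by rewrite eqxx.
Qed.

(** Injectivity gives existence in finite dimension. The transpose of a solution solves the same
    equation, so uniqueness makes the solution symmetric. *)
Lemma lyapunovP P Xi : pdmx P -> Xi^T = Xi ->
  (lyapunov P Xi)^T = lyapunov P Xi /\
  2 *: Xi = P *m lyapunov P Xi + lyapunov P Xi *m P.
Proof.
move=> Pp Xs.
pose U := vec_mx (mxvec (2 *: Xi) *m invmx (lyapunov_op P)).
have UE : P *m U + U *m P = 2 *: Xi.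
  apply: (can_inj mxvecK); rewrite -lyapunov_opE vec_mxK mulmxKV//.
  exact: lyapunov_op_unit.
have Us : U^T = U.
  apply/eqP; rewrite -subr_eq0; apply/eqP; apply: (lyapunov_inj Pp).
  rewrite mulmxBr mulmxBl addrACA -opprD UE.
  have -> : P *m U^T = (U *m P)^T by rewrite trmx_mul Pp.1.
  have -> : U^T *m P = (P *m U)^T by rewrite trmx_mul Pp.1.
  rewrite -linearD /= [X in X^T]addrC UE.
  by rewrite linearZ /= Xs subrr.
exact: (@xgetI _ 0 [set V | V^T = V /\ 2 *: Xi = P *m V + V *m P] U (conj Us (esym UE))).
Qed.

Lemma lyapunovE P Xi U : pdmx P -> U^T = U -> 2 *: Xi = P *m U + U *m P ->
  lyapunov P Xi = U.
Proof.
move=> Pp Us UE.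
have [_ LE] :=
  @xgetI _ 0 [set V | V^T = V /\ 2 *: Xi = P *m V + V *m P] U (conj Us UE).
apply/eqP; rewrite -subr_eq0; apply/eqP; apply: (lyapunov_inj Pp).
by rewrite mulmxBr mulmxBl addrACA -opprD -LE -UE subrr.
Qed.

(** Replaces the choice made by [xget] with an expression continuous in [P] and [Xi], from which the
    continuity of the Bures speed follows. *)
Lemma lyapunov_formula P Xi : pdmx P -> Xi^T = Xi ->
  lyapunov P Xi = vec_mx (mxvec (2 *: Xi) *m invmx (lyapunov_op P)).
Proof.
move=> Pp Xs; have [_ ->] := lyapunovP Pp Xs.
by rewrite -lyapunov_opE mulmxK ?mxvecK ?lyapunov_op_unit.
Qed.

Lemma cvg_lyapunov_op {T : Type} {F : set_system T} {FF : Filter F}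
  (P : T -> 'M[R]_d) (P0 : 'M[R]_d) : P @ F --> P0 ->
  (fun x => lyapunov_op (P x)) @ F --> lyapunov_op P0.
Proof.
move=> PP0; have vec n m (M : T -> 'M[R]_(m, n)) (L : 'M[R]_(m, n)) i j :
    M @ F --> L -> (fun x => mxvec (M x) i j) @ F --> mxvec L i j.
  rewrite (ord1 i); case/mxvec_indexP: j => k l.
  by rewrite mxvecE; under eq_fun do rewrite mxvecE; exact: cvg_mx_entry.
apply: cvgD; apply: cvg_mx => i j; rewrite !mxE; under eq_fun do rewrite !mxE /=.
  by apply: vec; apply: cvg_mulmx => //; exact: cvg_cst.
by apply: vec; apply: cvg_mulmx => //; exact: cvg_cst.
Qed.

Lemma cvg_lyapunov {T : Type} {F : set_system T} {FF : Filter F}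
  (P Xi : T -> 'M[R]_d) (P0 Xi0 : 'M[R]_d) : P @ F --> P0 -> Xi @ F --> Xi0 ->
  pdmx P0 -> Xi0^T = Xi0 -> (\forall x \near F, pdmx (P x) /\ (Xi x)^T = Xi x) ->
  (fun x => lyapunov (P x) (Xi x)) @ F --> lyapunov P0 Xi0.
Proof.
move=> PP0 XX0 P0p X0s Ps.
apply: (@cvg_trans _ ((fun x =>
    vec_mx (mxvec (2 *: Xi x) *m invmx (lyapunov_op (P x)))) @ F)).
  apply: near_eq_cvg; apply: filterS Ps => x [? ?].
  by rewrite lyapunov_formula.
rewrite lyapunov_formula//; apply: cvg_mx => i j; rewrite mxE.
under eq_fun do rewrite mxE.
apply: cvg_mx_entry; apply: cvg_mulmx.
  apply: cvg_mx => k l; rewrite (ord1 k); case/mxvec_indexP: l => a b.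
  rewrite mxvecE; under eq_fun do rewrite mxvecE.
  by apply: cvg_mx_entry; apply: cvgZ => //; exact: cvg_cst.
by apply: cvg_invmx; [exact: lyapunov_op_unit|exact: cvg_lyapunov_op].
Qed.

Lemma bures_metric_ge0 P Xi : pdmx P -> 0 <= bures_metric P Xi Xi.
Proof. by move=> Pp; exact/psd_inner_ge0/pd_psd. Qed.

(** [2 *: Xi] is the sum of [P U] and [U P], which are transposes of each other and so have the same
    pairing with the symmetric [Phi]. *)
Lemma lyapunov_inner P Xi Phi : pdmx P -> Xi^T = Xi -> Phi^T = Phi ->
  inner Phi Xi = inner (P *m lyapunov P Xi) Phi.
Proof.
move=> Pp Xs Phis; have [Us UE] := lyapunovP Pp Xs.
set U := lyapunov P Xi in Us UE *.
have : 2 * inner Phi Xi = inner (P *m U) Phi + inner (U *m P) Phi.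
  by rewrite innerC -innerZl UE innerDl.
have -> : inner (U *m P) Phi = inner (P *m U) Phi.
  rewrite inner_mulr inner_mull Pp.1 /inner !trmx_mul Pp.1 Phis mxtrace_mulC.
  by rewrite -mxtrace_tr !trmx_mul Pp.1 Us Phis.
lra.
Qed.

(** This is [psd_Young] for [k *: Phi], divided by [k]. The weight [k] will be the rate of a change
    of time, which multiplies the derivative of the calibration. *)
Lemma bures_metric_Young P Xi Phi k : pdmx P -> Xi^T = Xi -> Phi^T = Phi -> 0 < k ->
  inner Phi Xi <= k^-1 * bures_metric P Xi Xi + k / 4 * inner (P *m Phi) Phi.
Proof.
move=> Pp Xs Phis k0; rewrite (lyapunov_inner Pp Xs Phis) /bures_metric.
set U := lyapunov P Xi.
have := psd_Young U (k *: Phi) (pd_psd Pp).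
rewrite -scalemxAr innerZl !innerZr => h.
rewrite -(ler_pM2l k0) mulrDr mulrA divff ?gt_eqF// mul1r.
by apply: (le_trans h); rewrite le_eqVlt; apply/orP; left; apply/eqP; field.
Qed.

End Lyapunov.

(** * Length of curves of positive definite matrices *)

Section RealCalculus.
Context {R : realType}.
Implicit Types (a b t : R) (f : R -> R).

(* The fundamental theorem of calculus and the theorems on parametrized integrals
   want two-sided neighbourhoods; functions known on [a, b] only are extended
   continuously by clamping their argument. *)
Definition clamp a b t : R := (a + b + `|t - a| - `|t - b|) / 2.

Lemma clamp_in a b t : a <= b -> a <= clamp a b t <= b.
Proof.
move=> ab; rewrite /clamp; case: (leP a t) => at_; case: (leP b t) => bt.
- by rewrite !ger0_norm ?subr_ge0//; lra.
- by rewrite ger0_norm ?subr_ge0// ltr0_norm ?subr_lt0//; lra.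
- by rewrite (ltr0_norm (x := t - a)) ?subr_lt0// ger0_norm ?subr_ge0//; lra.
- by rewrite !ltr0_norm ?subr_lt0//; lra.
Qed.

Lemma clamp_id a b t : a <= t <= b -> clamp a b t = t.
Proof.
move=> /andP[at_ tb]; rewrite /clamp ger0_norm ?subr_ge0// ler0_norm ?subr_le0//.
by field.
Qed.

Lemma continuous_clamp a b : continuous (clamp a b).
Proof.
move=> t; apply: cvgM; last exact: cvg_cst.
by apply: cvgB; [apply: cvgD; first exact: cvg_cst|];
  apply: cvg_norm; apply: cvgB; (exact: cvg_id || exact: cvg_cst).
Qed.

Lemma itv_integrable f a b : {within `[a, b], continuous f} ->
  lebesgue_measure.-integrable `[a, b] (EFin \o f).
Proof. exact: continuous_compact_integrable (@segment_compact _ a b). Qed.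

Lemma is_derive_continuous (V : normedModType R) (f : R -> V) t (D : V) :
  is_derive t 1 f D -> {for t, continuous f}.
Proof. by move=> [dft _]; exact/differentiable_continuous/derivable1_diffP. Qed.

Lemma continuous_primitive f a b : a < b -> continuous f ->
  exists2 F : R -> R, forall t, a <= t <= b -> is_derive t 1 F (f t) &
    (\int[lebesgue_measure]_(t in `[a, b]) (f t)%:E = (F b - F a)%:E)%E.
Proof.
move=> ab cf.
(* Starting at [a - 1] makes [a] an interior point, as the bound [b + 1] below does for [b]; the
   primitive is then differentiable on both sides at the end points. *)
pose F x := (\int[lebesgue_measure]_(t in [set` `[a - 1, x]]) (f t))%R.
have dF t : a <= t <= b -> is_derive t 1 F (f t).
  move=> /andP[at_ tb].
  have tb1 : t < b + 1 by lra.
  have at1 : a - 1 < t by lra.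
  have [dFt F't] := continuous_FTC1_closed tb1
    (itv_integrable (continuous_subspaceT cf)) at1 (cf t).
  by apply: DeriveDef; [exact: dFt|rewrite -derive1E; exact: F't].
exists F => //; rewrite EFinB; apply: continuous_FTC2 => //.
- exact: continuous_subspaceT.
- split.
  + move=> t; rewrite in_itv /= => /andP[/ltW at_ /ltW tb].
    by have [] := dF t _; rewrite ?at_ ?tb.
  + apply: cvg_at_right_filter; apply: is_derive_continuous.
    by apply: dF; rewrite lexx ltW.
  + apply: cvg_at_left_filter; apply: is_derive_continuous.
    by apply: dF; rewrite lexx ltW.
- move=> t; rewrite in_itv /= => /andP[/ltW at_ /ltW tb].
  have tab : a <= t <= b by rewrite at_.
  by rewrite derive1E; have [_ ->] := dF t tab.
Qed.

Lemma is_derive_ge0_le f a b (df : R -> R) : a <= b ->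
  (forall t, a <= t <= b -> is_derive t 1 f (df t)) ->
  (forall t, a <= t <= b -> 0 <= df t) -> f a <= f b.
Proof.
move=> ab dfE df0; apply: (@ger0_derive1_le_cc _ f a b) => //.
- move=> t; rewrite in_itv /= => /andP[/ltW at_ /ltW tb].
  by have [] := dfE t _; rewrite ?at_ ?tb.
- move=> t; rewrite in_itv /= => /andP[/ltW at_ /ltW tb].
  have tab : a <= t <= b by rewrite at_.
  by rewrite derive1E; have [_ ->] := dfE t tab; exact: df0.
- apply: derivable_within_continuous => t; rewrite in_itv /= => tab.
  by have [] := dfE t tab.
- by rewrite in_itv /= lexx.
- by rewrite in_itv /= lexx andbT.
Qed.

End RealCalculus.

Section CurveLength.
Context {R : realType} {d : nat}.
Implicit Types (e : R -> 'M[R]_d) (a b t : R).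

Definition bures_speed e t : R :=
  Num.sqrt (bures_metric (e t) (derive1 e t) (derive1 e t)).

Lemma derive1_sym e t : derivable e t 1 -> (forall s, (e s)^T = e s) ->
  (derive1 e t)^T = derive1 e t.
Proof.
move=> de es; rewrite derive1E derive_mx//; apply/matrixP => i j; rewrite !mxE.
by congr ('D_1 _ t); apply/funext => s; rewrite -{1}es mxE.
Qed.

(** A piece of a curve of positive matrices is the restriction of a C^1 curve that may leave the
    symmetric matrices outside the piece. Taking the symmetric part keeps the values on the piece
    and makes the derivative symmetric up to its end points. *)
Lemma C1_curve_sym e : C1_curve e -> exists e', [/\ C1_curve e',
  forall t, (e' t)^T = e' t & forall t, (e t)^T = e t -> e' t = e t].
Proof.
move=> [de ce]; pose D t := 2^-1 *: (derive1 e t + (derive1 e t)^T).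
pose e' t := 2^-1 *: (e t + (e t)^T).
have dee t : is_derive t 1 e (derive1 e t) by rewrite derive1E; exact/derivableP/de.
have dT t : is_derive t 1 (fun x => (e x)^T) (derive1 e t)^T.
  apply: is_derive_mx => i j; rewrite mxE.
  rewrite (_ : (fun x => _) = (fun x => e x j i)); last by apply/funext => x; rewrite mxE.
  exact: is_derive_mx_entry.
have de' t : is_derive t 1 e' (D t) := is_deriveZ _ (is_deriveD (dee t) (dT t)).
exists e'; split.
- split=> [t|]; first by case: (de' t).
  rewrite (_ : derive1 e' = D); last first.
    by apply/funext => t; rewrite derive1E; case: (de' t).
  move=> t; apply: cvgZ; first exact: cvg_cst.
  apply: cvgD; first exact: ce.
  apply: cvg_mx => i j; rewrite mxE; under eq_fun do rewrite mxE.
  by apply: cvg_mx_entry; exact: ce.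
- by move=> t; rewrite linearZ linearD /= trmxK addrC.
- by move=> t et; rewrite /e' et scalerDr -scalerDl (_ : _ + _ = 1) ?scale1r//; field.
Qed.

Lemma continuous_clamp_speed e a b : a <= b -> C1_curve e ->
  (forall t, (e t)^T = e t) -> (forall t, a <= t <= b -> pdmx (e t)) ->
  continuous (fun t => bures_speed e (clamp a b t)).
Proof.
move=> ab [de ce] es ep t.
have cce : continuous e.
  by move=> s; exact/differentiable_continuous/derivable1_diffP/de.
have ce1 : e (clamp a b x) @[x --> t] --> e (clamp a b t).
  by apply: continuous_cvg; [exact: cce|exact: continuous_clamp].
have ce2 : derive1 e (clamp a b x) @[x --> t] --> derive1 e (clamp a b t).
  by apply: continuous_cvg; [exact: ce|exact: continuous_clamp].
have cl : lyapunov (e (clamp a b x)) (derive1 e (clamp a b x)) @[x --> t] -->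
    lyapunov (e (clamp a b t)) (derive1 e (clamp a b t)).
  apply: cvg_lyapunov => //; first by apply: ep; exact: clamp_in.
  - exact: derive1_sym (de _) es.
  - near=> s; split; first by apply: ep; exact: clamp_in.
    exact: derive1_sym (de _) es.
have cm : bures_metric (e (clamp a b x)) (derive1 e (clamp a b x))
    (derive1 e (clamp a b x)) @[x --> t] -->
    bures_metric (e (clamp a b t)) (derive1 e (clamp a b t)) (derive1 e (clamp a b t)).
  by apply: cvg_inner => //; exact: cvg_mulmx.
exact: (cvg_comp _ _ cm (@sqrt_continuous R _)).
Unshelve. all: by end_near. Qed.

(* Reparametrize by theta proportional to arc length (plus a small multiple of
   time, to have theta' > 0) and differentiate calib theta : e.  The equation for
   calib and Young's inequality bound the derivative by a multiple of the speed,
   so the total increment, which is the cost, is at most the square of the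
   length. *)
Lemma bures_cost_le_primitive e a b (W : R -> R) (k : R) : a < b -> 0 < k ->
  C1_curve e -> (forall t, (e t)^T = e t) -> (forall t, a <= t <= b -> pdmx (e t)) ->
  (forall t, a <= t <= b -> is_derive t 1 W (bures_speed e t)) ->
  Num.sqrt (bures_cost (e a) (e b)) <= W b - W a + k * (b - a).
Proof.
move=> ab k0 [de ce] es ep dW.
pose F t := W t + k * t.
have dF t : a <= t <= b -> is_derive t 1 F (bures_speed e t + k).
  move=> tab; have dWt := dW t tab.
  have : is_derive t 1 (W + (k *: id : R -> R)) (bures_speed e t + k *: 1).
    exact: is_deriveD.
  by rewrite /GRing.scale/= mulr1.
have f0 t : 0 < bures_speed e t + k by rewrite ltr_wpDl// sqrtr_ge0.
have Fle s t : a <= s <= t -> t <= b -> F s <= F t.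
  move=> /andP[as_ st] tb; apply: (is_derive_ge0_le st (df := fun t => bures_speed e t + k)).
    by move=> x /andP[sx xt]; apply: dF; rewrite (le_trans as_ sx) (le_trans xt tb).
  by move=> x _; exact/ltW.
pose L := F b - F a.
have L0 : 0 < L.
  have W_le : W a <= W b.
    apply: (is_derive_ge0_le (ltW ab) dW) => t _; exact: sqrtr_ge0.
  have : 0 < k * (b - a) by rewrite mulr_gt0// subr_gt0.
  by rewrite /L /F; lra.
have -> : W b - W a + k * (b - a) = L by rewrite /L /F; ring.
pose th t := (F t - F a) / L.
have th01 t : a <= t <= b -> 0 <= th t <= 1.
  move=> /andP[at_ tb]; have Fa : F a <= F t by apply: Fle; rewrite ?lexx.
  have Fb : F t <= F b by apply: Fle; rewrite ?at_.
  apply/andP; split.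
    by apply: divr_ge0; [rewrite subr_ge0|exact: ltW].
  by rewrite ler_pdivrMr// mul1r lerD2r.
have dth t : a <= t <= b -> is_derive t 1 th ((bures_speed e t + k) / L).
  move=> tab; have dFt := dF t tab.
  have : is_derive t 1 (L^-1 *: (F - cst (F a)) : R -> R)
    (L^-1 *: (bures_speed e t + k - 0)) by exact: is_deriveZ.
  rewrite subr0 {2}/GRing.scale/= mulrC.
  by rewrite (_ : _ *: _ = th)//; apply/funext => x; rewrite /th mulrC.
have ea : pdmx (e a) by apply: ep; rewrite lexx ltW.
have eb : pdmx (e b) by apply: ep; rewrite lexx ltW.
have [Tp Te] := transportP ea eb; set T := transport (e a) (e b) in Tp Te.
pose h t := inner (calib T (th t)) (e t).
pose dh t := inner (((bures_speed e t + k) / L) *: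
    (- 4^-1 *: (calib T (th t) *m calib T (th t)))) (e t) +
  inner (calib T (th t)) (derive1 e t).
have dhP t : a <= t <= b -> is_derive t 1 h (dh t).
  move=> tab; apply: is_derive_inner; last by rewrite derive1E; exact/derivableP/de.
  apply: is_derive_mx => i j; rewrite mxE mulrC.
  have u : interp_mx T (th t) \in unitmx by apply: pd_unitmx; exact/interp_mx_pd/th01.
  have dc := is_derive_mx_entry i j (is_derive_calib u).
  exact: (is_derive1_comp (f := fun s => calib T s i j) (g := th) dc (dth t tab)).
have dh_le t : a <= t <= b -> dh t <= L * (bures_speed e t + k).
  move=> tab; rewrite /dh.
  set Phi := calib T (th t).
  have Phis : Phi^T = Phi by exact: calib_sym.
  clearbody Phi.
  set r := (bures_speed e t + k) / L.
  have r0 : 0 < r by rewrite divr_gt0.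
  have dsym := derive1_sym (de t) es.
  have := bures_metric_Young (ep t tab) dsym Phis r0.
  have -> : inner (e t *m Phi) Phi = inner (Phi *m Phi) (e t).
    by rewrite inner_mulr Phis innerC.
  rewrite !innerZl.
  have m0 := bures_metric_ge0 (derive1 e t) (ep t tab).
  have := sqr_sqrtr m0; rewrite -/(bures_speed e t) => <-.
  have v0 : 0 <= bures_speed e t by exact: sqrtr_ge0.
  move=> Y.
  (* With [v] the speed and [r = (v + k) / L], the left side is [L v^2 / (v + k)], and
     [v^2 <= (v + k)^2]. *)
  have : r^-1 * bures_speed e t ^+ 2 <= L * (bures_speed e t + k).
    rewrite /r invf_div mulrAC ler_pdivrMr ?f0// -mulrA ler_pM2l//.
    have kv : 0 <= bures_speed e t * k by rewrite mulr_ge0// ltW.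
    have := sqr_ge0 k; lra.
  lra.
have dk t : a <= t <= b -> is_derive t 1 (L *: F - h : R -> R)
    (L *: (bures_speed e t + k) - dh t).
  by move=> tab; exact: is_deriveB (is_deriveZ _ (dF t tab)) (dhP t tab).
have k_le : (L *: F - h : R -> R) a <= (L *: F - h : R -> R) b.
  by apply: (is_derive_ge0_le (ltW ab) dk) => t tab; rewrite subr_ge0 dh_le.
have thb : th b = 1 by rewrite /th -/L divff ?gt_eqF.
have tha : th a = 0 by rewrite /th subrr mul0r.
have : bures_cost (e a) (e b) <= L ^+ 2.
  have := calib_boundary Tp ea.1; rewrite Te -/(bures_cost _ _) => <-.
  have : L * F a - h a <= L * F b - h b by exact: k_le.
  by rewrite /h tha thb /L; nra.
by move=> /ler_wsqrtr /le_trans; apply; rewrite sqrtr_sqr (ger0_norm (ltW L0)).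
Qed.

Lemma bures_cost_le_length e a b : a < b ->
  C1_curve e -> (forall t, (e t)^T = e t) -> (forall t, a <= t <= b -> pdmx (e t)) ->
  measurable_fun `[a, b] (bures_speed e) /\
  ((Num.sqrt (bures_cost (e a) (e b)))%:E <=
   \int[lebesgue_measure]_(t in `[a, b]) (bures_speed e t)%:E)%E.
Proof.
move=> ab eC es ep.
have cw := continuous_clamp_speed (ltW ab) eC es ep.
have wE : {in `[a, b]%classic, (fun t => bures_speed e (clamp a b t)) =1 bures_speed e}.
  by move=> t /set_mem; rewrite /= in_itv /= => /clamp_id ->.
have [W dW WE] := continuous_primitive ab cw.
split.
  apply: (eq_measurable_fun _ wE); apply: measurable_funTS.
  exact: continuous_measurable_fun.
rewrite [leRHS](_ : _ =
    \int[lebesgue_measure]_(t in `[a, b]) (bures_speed e (clamp a b t))%:E)%E; last first.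
  by apply: eq_integral => t tab; rewrite (wE t tab).
rewrite WE; apply/lee_addgt0Pr => k k0; rewrite -EFinD lee_fin.
(* The arbitrary slack is spread over the interval: [k / (b - a)] is the multiple of time added to
   the arc length. *)
have -> : k = k / (b - a) * (b - a) by rewrite divfK// gt_eqF// subr_gt0.
apply: bures_cost_le_primitive => //; first by rewrite divr_gt0// subr_gt0.
by move=> t tab; have := dW t tab; rewrite clamp_id.
Qed.

End CurveLength.

(** * The Bures distance *)

Section BuresDistance.
Context {R : realType} {d : nat}.
Implicit Types (c : R -> pdMatrix R d) (e : R -> 'M[R]_d) (a b t : R).

(** Equal factors of both matrices bound the cost by 0, so [transport P P] need not be
    identified. *)
Lemma bures_cost_refl (P : 'M[R]_d) : pdmx P -> bures_cost P P = 0.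
Proof.
move=> Pp; have [X [Xp XX]] := pd_sqrt Pp.
have XXt : X *m X^T = P by rewrite Xp.1.
apply/eqP; rewrite eq_le bures_cost_ge0 ?andbT; last exact: pd_psd.
by apply: le_trans (bures_cost_frame Pp Pp XXt XXt) _; rewrite subrr inner0l mulr0.
Qed.

Lemma near_itvoo_eq (T : Type) (f g : R -> T) a b t :
  (forall s, a < s < b -> f s = g s) -> a < t < b -> {near t, f =1 g}.
Proof.
move=> fg /andP[at_ tb]; near=> s; apply: fg; apply/andP; split.
  by near: s; exact: lt_nbhsr.
by near: s; exact: lt_nbhsl.
Unshelve. all: by end_near. Qed.

Lemma bures_speed_eq e e' a b t : (forall s, a < s < b -> e s = e' s) ->
  a < t < b -> bures_speed e t = bures_speed e' t.
Proof.
move=> ee' atb; have eN := near_itvoo_eq ee' atb.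
by rewrite /bures_speed !derive1E (near_eq_derive _ eN) (ee' _ atb).
Qed.

(** At a break point [derive1] of the curve says nothing about the one-sided derivatives, so speeds
    are compared on the open interval only. The half-open interval makes consecutive pieces
    disjoint. *)
Lemma bures_cost_le_piece c a b : a < b ->
  (exists2 e, C1_curve e & forall t, a <= t <= b -> pdval (c t) = e t) ->
  measurable_fun `]a, b] (bures_speed (pdval \o c)) /\
  ((Num.sqrt (bures_cost (c a) (c b)))%:E <=
    \int[lebesgue_measure]_(t in `]a, b]) (bures_speed (pdval \o c) t)%:E)%E.
Proof.
move=> ab [e0 /C1_curve_sym[e [eC es ee0]] ce0].
have ce t : a <= t <= b -> pdval (c t) = e t.
  by move=> tab; rewrite ce0// ee0// -ce0//; exact: (pdvalP (c t)).1.
have ep t : a <= t <= b -> pdmx (e t) by move=> tab; rewrite -ce//; exact: pdvalP.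
have [me le] := bures_cost_le_length ab eC es ep.
have ve t : a < t < b -> bures_speed e t = bures_speed (pdval \o c) t.
  apply: bures_speed_eq => s /andP[/ltW as_ /ltW sb].
  by rewrite /= ce// as_.
have mc : measurable_fun `]a, b[ (bures_speed (pdval \o c)).
  apply: (@eq_measurable_fun _ _ _ _ _ (bures_speed e)).
    by move=> t; rewrite inE /= in_itv /= => /ve.
  apply: measurable_funS me => //; exact: subset_itv_oo_cc.
split; first exact/measurable_fun_itv_bndo_bndcP.
have ca : pdval (c a) = e a by apply: ce; rewrite lexx ltW.
have cb : pdval (c b) = e b by apply: ce; rewrite lexx ltW.
rewrite ca cb.
apply: (le_trans le).
rewrite integral_itv_bndoo; last first.
  apply/measurable_EFinP; apply: measurable_funS me => //; exact: subset_itv_oo_cc.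
rewrite [leRHS]integral_itv_bndoo; last exact/measurable_EFinP.
rewrite le_eqVlt; apply/orP; left; apply/eqP; apply: eq_integral => t.
by rewrite inE /= in_itv /= => /ve ->.
Qed.

(** Induction on the break points: the root of the cost is subadditive by [bures_cost_triangle],
    while the integral of the speed is additive. The empty list corresponds to the empty interval
    []a, a]] and to cost 0. *)
Lemma bures_cost_le_path c a (s : seq R) : path <%R a s ->
  (forall k, (k < size s)%N -> exists2 e, C1_curve e &
    forall t, nth 0 (a :: s) k <= t <= nth 0 s k -> pdval (c t) = e t) ->
  a <= last a s /\
  measurable_fun `]a, last a s] (bures_speed (pdval \o c)) /\
  ((Num.sqrt (bures_cost (c a) (c (last a s))))%:E <=
    \int[lebesgue_measure]_(t in `]a, last a s]) (bures_speed (pdval \o c) t)%:E)%E.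
Proof.
elim: s a => [a _ _ /=|b s IH a /= /andP[ab bs] pieces].
  split=> //; rewrite set_interval.set_itvoc0; split; first exact: measurable_fun_set0.
  by rewrite integral_set0 bures_cost_refl ?sqrtr0//; exact: pdvalP.
have [|bl [m2 l2]] := IH b bs; first by move=> k ks; exact: (pieces k.+1).
have [m1 l1] := bures_cost_le_piece ab (pieces 0 isT).
split; first exact: le_trans (ltW ab) bl.
have U : `]a, last b s]%classic = `]a, b] `|` `]b, last b s].
  by rewrite -itv_bndbnd_setU// bnd_simp ltW.
have mU : measurable_fun (`]a, b] `|` `]b, last b s]) (bures_speed (pdval \o c)).
  exact/measurable_funU.
rewrite U; split => //.
rewrite ge0_integral_setU//=; last 3 first.
- exact/measurable_EFinP.
- by move=> t _; rewrite lee_fin sqrtr_ge0.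
- apply/disj_setPS => t [/=]; rewrite !in_itv /= => /andP[_ tb] /andP[bt _].
  by have := le_lt_trans tb bt; rewrite ltxx.
apply: le_trans (leeD l1 l2); rewrite -EFinD lee_fin.
by apply: bures_cost_triangle; exact: pdvalP.
Qed.

Lemma bures_cost_le_bures_length c : piecewise_C1 (pdval \o c) ->
  ((Num.sqrt (bures_cost (c 0) (c 1)))%:E <= bures_length (pdval \o c))%E.
Proof.
move=> [s [s0 s1 pieces]]; have [_ [m l]] := bures_cost_le_path s0 pieces.
rewrite s1 in m l; apply: (le_trans l); rewrite /bures_length.
by rewrite (integral_itv_obnd_cbnd (f := fun t => (bures_speed (pdval \o c) t)%:E))//;
  exact/measurable_EFinP.
Qed.

(** * The optimal path of matrices *)

Section OptimalPath.
Variables (T P0 : 'M[R]_d).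
Hypotheses (Tp : pdmx T) (P0p : pdmx P0).

Definition bures_path t : 'M[R]_d := interp_mx T t *m P0 *m interp_mx T t.

Definition bures_path_velocity t : 'M[R]_d :=
  (T - 1%:M) *m P0 *m interp_mx T t + interp_mx T t *m P0 *m (T - 1%:M).

Lemma bures_path_pd t : 0 <= t <= 1 -> pdmx (bures_path t).
Proof. by move=> t01; apply: pd_conj_sym => //; exact: interp_mx_pd. Qed.

Lemma is_derive_bures_path t : is_derive t 1 bures_path (bures_path_velocity t).
Proof.
have dA := is_derive_interp_mx T t.
have dP : is_derive t 1 (fun=> P0 : 'M[R]_d) 0 by exact: is_derive_cst.
have := is_derive_mulmx (is_derive_mulmx dA dP) dA.
by rewrite mulmx0 addr0.
Qed.

Lemma continuous_interp_mx : continuous (interp_mx T).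
Proof. by move=> t; apply: is_derive_continuous; exact: is_derive_interp_mx. Qed.

Lemma C1_bures_path : C1_curve bures_path.
Proof.
have dE t := is_derive_bures_path t.
split=> [t|]; first by case: (dE t).
rewrite (_ : derive1 bures_path = bures_path_velocity); last first.
  by apply/funext => t; rewrite derive1E; case: (dE t).
move=> t; have cA := @continuous_interp_mx t.
apply: cvgD; apply: cvg_mulmx; try exact: cvg_cst; first exact: cA.
by apply: cvg_mulmx; [exact: cA|exact: cvg_cst].
Qed.

(** Write [A = 1 + t S]. Half of [calib] is [2 S A^-1 = 2 A^-1 S], so on either side it cancels one
    outer factor of [A P0 A] and leaves [2 A P0 S] and [2 S P0 A]. *)
Lemma bures_path_lyapunov t : 0 <= t <= 1 ->
  lyapunov (bures_path t) (bures_path_velocity t) = 2^-1 *: calib T t.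
Proof.
move=> t01; have u := pd_unitmx (interp_mx_pd Tp t01).
apply: lyapunovE; first exact: bures_path_pd.
  by rewrite linearZ /= calib_sym.
rewrite /calib scalerA -scalemxAr -scalemxAl -scalerDr.
rewrite (_ : 2^-1 * 4 = 2); last by field.
congr (_ *: _); rewrite /bures_path /bures_path_velocity addrC.
congr (_ + _); first by rewrite (interp_mxVC T t) !mulmxA mulmxK.
by rewrite !mulmxA mulmxKV.
Qed.

(** The inverses in the two copies of [calib] cancel both outer factors of the path, so no [t]
    remains: the speed is constant. *)
Lemma inner_bures_path_calib t : 0 <= t <= 1 ->
  inner (bures_path t *m (2^-1 *: calib T t)) (2^-1 *: calib T t) =
  4 * inner (P0 *m (T - 1%:M)) (T - 1%:M).
Proof.
move=> t01; have u := pd_unitmx (interp_mx_pd Tp t01).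
rewrite -scalemxAr innerZl innerZr.
have -> : bures_path t *m calib T t = 4 *: (interp_mx T t *m P0 *m (T - 1%:M)).
  by rewrite /bures_path /calib -scalemxAr interp_mxVC !mulmxA mulmxK.
rewrite /calib innerZl innerZr -!mulmxA inner_mull interp_mx_sym//.
by rewrite interp_mxVC mulKVmx//; field.
Qed.

End OptimalPath.

Lemma bures_metric_path (T P0 : 'M[R]_d) t : pdmx T -> pdmx P0 -> 0 <= t <= 1 ->
  bures_metric (bures_path T P0 t) (bures_path_velocity T P0 t)
    (bures_path_velocity T P0 t) = 4 * inner (P0 *m (T - 1%:M)) (T - 1%:M).
Proof.
move=> Tp P0p t01; rewrite /bures_metric bures_path_lyapunov//.
exact: inner_bures_path_calib.
Qed.

(** A curve in [pdMatrix] must be positive definite at every real time, while the path is known to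
    be so on [[0, 1]]; clamping the time freezes it outside. *)
Lemma bures_path_connects (P0 P1 : 'M[R]_d) : pdmx P0 -> pdmx P1 ->
  exists c, [/\ forall t, 0 <= t <= 1 -> pdval (c t) = bures_path (transport P0 P1) P0 t,
    pdval (c 0) = P0 & pdval (c 1) = P1].
Proof.
move=> P0p P1p; have [Tp TP] := transportP P0p P1p.
have c01 (t : R) : 0 <= clamp 0 1 t <= 1 by apply: clamp_in; exact: ler01.
exists (fun t => PdMatrix _ (bures_path_pd Tp P0p (c01 t))); split => /=.
- by move=> t /clamp_id ->.
- by rewrite clamp_id ?lexx ?ler01// /bures_path interp_mx0 mul1mx mulmx1.
- by rewrite clamp_id ?lexx ?ler01// /bures_path interp_mx1.
Qed.

Lemma bures_distE (P0 P1 : pdMatrix R d) :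
  bures_dist P0 P1 = (Num.sqrt (bures_cost P0 P1))%:E.
Proof.
have [P0p P1p] := (pdvalP P0, pdvalP P1); have [Tp TP] := transportP P0p P1p.
apply/eqP; rewrite eq_le; apply/andP; split; last first.
  apply: le_ereal_inf_tmp => _ [c [c_C1 <- <- ->]].
  exact: bures_cost_le_bures_length.
have [c [cE c0 c1]] := bures_path_connects P0p P1p.
apply: ereal_inf_lbound; exists c; split => //.
  exists [:: 1]; split; [by rewrite /= ltr01|by []|case=> // _ /=].
  exists (bures_path (transport P0 P1) P0); first exact: C1_bures_path.
  exact: cE.
(* The end points are excluded because the clamped curve may have kinks there; they do not affect
   the integral. *)
have vE t : 0 < t < 1 ->
    bures_speed (pdval \o c) t = Num.sqrt (bures_cost P0 P1).
  move=> t01; have t01' : 0 <= t <= 1 by case/andP: t01 => /ltW -> /ltW ->.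
  rewrite (@bures_speed_eq _ (bures_path (transport P0 P1) P0) 0 1)//; last first.
    by move=> s /andP[/ltW s0 /ltW s1]; apply: cE; rewrite s0.
  rewrite /bures_speed derive1E.
  have [_ ->] := is_derive_bures_path (transport P0 P1) P0 t.
  by rewrite bures_metric_path.
have mv : measurable_fun (`]0, 1[%classic : set R) (bures_speed (pdval \o c)).
  apply: (@eq_measurable_fun _ _ _ _ _ (cst (Num.sqrt (bures_cost P0 P1)))) => //.
  by move=> t; rewrite inE /= in_itv /= => /vE ->.
rewrite /bures_length.
rewrite (integral_itv_bndoo (f := fun t => (bures_speed (pdval \o c) t)%:E)); last first.
  exact/measurable_EFinP.
transitivity (\int[lebesgue_measure]_(t in `]0%R, 1%R[)
    (cst (Num.sqrt (bures_cost P0 P1))%:E t))%E; last first.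
  by apply: eq_integral => t; rewrite inE /= in_itv /= => /vE ->.
rewrite integral_cst//= lebesgue_measure_itv/= lte_fin ltr01.
by rewrite -EFinB subr0 mule1.
Qed.

End BuresDistance.

(** * Integrals of possibly non-measurable functions *)

(* The integral of a nonnegative function is the supremum of the integrals of
   the simple functions below it, so monotonicity and subadditivity against a
   measurable summand need no measurability. *)
Section LowerIntegral.
Context d (T : measurableType d) (R : realType).
Variable mu : {measure set T -> \bar R}.
Local Open Scope ereal_scope.
Import HBNNSimple.

Lemma ge0_lower_integral_le (D : set T) (f g : T -> \bar R) :
  (forall x, D x -> 0 <= f x) -> (forall x, D x -> f x <= g x) ->
  \int[mu]_(x in D) f x <= \int[mu]_(x in D) g x.
Proof.
move=> f0 fg; have g0 x : D x -> 0 <= g x by move=> Dx; exact: le_trans (f0 _ Dx) (fg _ Dx).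
rewrite !ge0_integralE//= ge_ereal_sup// => _ [s /= sf] <-.
apply: le_ereal_sup_tmp; exists (sintegral mu s) => //; exists s => //= x.
apply: (le_trans (sf x)); rewrite /patch; case: ifPn => //.
by rewrite inE => /fg.
Qed.

Lemma integral_nnsfunT (s : {nnsfun T >-> R}) :
  \int[mu]_x (s x)%:E = sintegral mu s.
Proof. by rewrite integral_nnsfun// patch_setT. Qed.

(** If a simple [s] lies below [h + f], then [max (s - f) 0] is measurable, lies below [h], and its
    sum with [f] is at least [s]. Additivity is applied to this measurable pair. *)
Lemma lower_integralD_le (h : T -> \bar R) (f : T -> R) :
  (forall x, 0 <= h x) -> (forall x, (0 <= f x)%R) -> measurable_fun setT f ->
  \int[mu]_x (h x + (f x)%:E) <= \int[mu]_x h x + \int[mu]_x (f x)%:E.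
Proof.
move=> h0 f0 mf; rewrite ge0_integralTE; last first.
  by move=> x; rewrite adde_ge0// lee_fin.
rewrite ge_ereal_sup// => _ [s /= sle] <-; rewrite -integral_nnsfunT.
have ms : measurable_fun setT s by exact: measurable_funPT.
have mw : measurable_fun setT (fun x => Num.max (s x - f x) 0)%R.
  by apply: measurable_maxr => //; exact: measurable_funB.
apply: (@le_trans _ _ (\int[mu]_x ((Num.max (s x - f x) 0)%:E + (f x)%:E)%R)).
  apply: ge0_lower_integral_le => x _; first by rewrite lee_fin.
  by rewrite -EFinD lee_fin -lerBlDr le_max lexx.
rewrite ge0_integralD//=; last 4 first.
- by move=> x _; rewrite lee_fin le_max lexx orbT.
- exact/measurable_EFinP.
- by move=> x _; rewrite lee_fin.
- exact/measurable_EFinP.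
rewrite leeD2r//; apply: ge0_lower_integral_le => x _.
  by rewrite lee_fin le_max lexx orbT.
rewrite EFin_max ge_max h0 andbT EFinB leeBlDr//.
Qed.

(** In the application [f1] is the pairing with the time derivative of the calibration, [f2] the
    pairing with [U], and [h] the action; no measurability of [f2] or [h] is assumed. *)
Lemma Rintegral_lower_bound (D : set T) (f1 f2 : T -> R) (h : T -> \bar R) :
  measurable D -> mu.-integrable D (EFin \o f1) -> (forall x, D x -> (f1 x <= 0)%R) ->
  (forall x, D x -> 0 <= h x) -> \int[mu]_(x in D) h x < +oo ->
  (forall x, D x -> (f2 x)%:E <= h x + (- f1 x)%:E) ->
  (Rintegral mu D f1 + Rintegral mu D f2)%:E <= \int[mu]_(x in D) h x.
Proof.
move=> mD if1 f10 h0 hoo f2h.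
have Nf10 x : D x -> 0 <= (- f1 x)%:E by move=> Dx; rewrite lee_fin oppr_ge0 f10.
have IN : \int[mu]_(x in D) (- f1 x)%:E = (- Rintegral mu D f1)%:E.
  rewrite /Rintegral EFinN fineK; last exact: integrable_fin_num.
  by rewrite -integralN//; exact: integrable_add_def.
have hfin : \int[mu]_(x in D) h x \is a fin_num.
  by rewrite ge0_fin_numE// integral_ge0.
have le1 : \int[mu]_(x in D) (h x + (- f1 x)%:E) <=
    \int[mu]_(x in D) h x + (- Rintegral mu D f1)%:E.
  rewrite -IN !(integral_mkcond D).
  have mf1 : measurable_fun setT ((fun x => (- f1 x)%R) \_ D).
    apply/(measurable_restrictT _ _).1 => //.
    by apply: measurableT_comp => //; exact/measurable_EFinP/(measurable_int _ if1).
  apply: le_trans; last first.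
    apply: le_trans (lower_integralD_le (h := h \_ D) _ _ mf1) _.
    - exact: erestrict_ge0.
    - by move=> x; rewrite /patch; case: ifPn => //; rewrite inE oppr_ge0 => /f10.
    - rewrite leeD2l// le_eqVlt; apply/orP; left; apply/eqP; apply: eq_integral.
      by move=> x _; rewrite /patch; case: ifP.
  apply: ge0_lower_integral_le => x _.
    rewrite /patch; case: ifPn => //; rewrite inE => Dx.
    by rewrite adde_ge0 ?h0 ?Nf10.
  by rewrite /patch; case: ifPn => //; rewrite adde0.
(* The integral of [f2] is the difference of the integrals of its positive and negative parts. The
   negative part is dropped, and the positive part is below [h - f1], which is nonnegative. *)
have le2 : \int[mu]_(x in D) (f2 x)%:E <= \int[mu]_(x in D) (h x + (- f1 x)%:E).
  rewrite integralE; apply: (@le_trans _ _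
      (\int[mu]_(x in D) ((fun x => (f2 x)%:E)^\+ x) - 0)).
    by rewrite leeB// integral_ge0.
  rewrite sube0; apply: ge0_lower_integral_le => x Dx //.
  by rewrite funeposE ge_max f2h//= adde_ge0 ?h0 ?Nf10.
have := le_trans le2 le1; rewrite -(fineK hfin) -EFinD => le3.
have hge : (0 <= fine (\int[mu]_(x in D) h x))%R.
  by rewrite fine_ge0// integral_ge0.
rewrite lee_fin -lerBrDl {1}/Rintegral.
(* The value [+oo] is excluded by the bound. At [-oo] the function [fine] returns 0, and the claim
   follows from the signs of [h] and [f1]. *)
case: (\int[mu]_(x in D) (f2 x)%:E) le3 => [r| |] //=.
move=> _; rewrite addr_ge0//.
by rewrite -lee_fin -IN integral_ge0.
Qed.

End LowerIntegral.

(** * Densities of matrix measures *)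

Section AeNonneg.
Context d (T : measurableType d) (R : realType).
Variable mu : {measure set T -> \bar R}.
Local Open Scope ereal_scope.

(** On the set where [f < 0] the integral of the absolute value is minus that of [f], hence zero, so
    [f] vanishes almost everywhere on a set where it is negative. *)
Lemma ae_ge0_integral_ge0 (f : T -> R) : mu.-integrable setT (EFin \o f) ->
  (forall A, measurable A -> 0 <= \int[mu]_(x in A) (f x)%:E) ->
  {ae mu, forall x, (0 <= f x)%R}.
Proof.
move=> intf f0; have mf : measurable_fun setT f.
  exact/measurable_EFinP/(measurable_int _ intf).
pose N := [set x | (f x < 0)%R].
have mN : measurable N.
  rewrite (_ : N = setT `&` f @^-1` [set` `]-oo, 0%R[]); first exact: mf.
  by rewrite setTI; apply/seteqP; split=> x; rewrite /N /= in_itv.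
have mfN : measurable_fun N (EFin \o f) by apply/measurable_EFinP; exact: measurable_funTS.
have intN : mu.-integrable N (EFin \o f).
  exact: (@integrableS _ _ _ mu setT).
have : ae_eq mu N (EFin \o f) (cst 0).
  apply/ae_eq_integral_abs => //.
  have -> : \int[mu]_(x in N) `|(EFin \o f) x| = - \int[mu]_(x in N) (f x)%:E.
    rewrite -integralN//=; last first.
      exact: integrable_add_def intN.
    apply: eq_integral => x; rewrite inE => Nx.
    by rewrite /= ltr0_norm ?EFinN.
  apply/eqP; rewrite eq_le oppe_le0 f0//= oppe_ge0.
  rewrite -oppe_ge0 -integralN//=; last first.
    exact: integrable_add_def intN.
  by apply: integral_ge0 => x Nx; rewrite lee_fin oppr_ge0 ltW.
apply: filterS => x fN; rewrite leNgt; apply/negP => fx.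
by have [] := fN fx => fx0; rewrite fx0 ltxx in fx.
Qed.

End AeNonneg.

Section MeasurableInner.
Context d (T : measurableType d) (R : realType).
Implicit Types D : set T.

Lemma measurable_mulmx m n p D (A : T -> 'M[R]_(m, n)) (B : T -> 'M[R]_(n, p)) :
  (forall i j, measurable_fun D (fun x => A x i j)) ->
  (forall i j, measurable_fun D (fun x => B x i j)) ->
  forall i j, measurable_fun D (fun x => (A x *m B x) i j).
Proof.
move=> mA mB i j; under eq_fun do rewrite mxE.
by apply: measurable_sum => k; exact: measurable_funM.
Qed.

Lemma measurable_inner m n D (A B : T -> 'M[R]_(m, n)) :
  (forall i j, measurable_fun D (fun x => A x i j)) ->
  (forall i j, measurable_fun D (fun x => B x i j)) ->
  measurable_fun D (fun x => inner (A x) (B x)).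
Proof.
move=> mA mB; under eq_fun do rewrite innerE.
by do 2!apply: measurable_sum => ?; exact: measurable_funM.
Qed.

End MeasurableInner.

Lemma psd_tr_eq0 (R : realType) d (P : 'M[R]_d) : psdmx P -> \tr P = 0 -> P = 0.
Proof.
move=> /psd_sqrt[B [[Bs _] <-]] BB.
by rewrite (@inner_eq0 _ _ _ B) ?mulmx0// /inner Bs.
Qed.

Lemma truncated_vector_cvg (R : realType) d (v : 'cV[R]_d) :
  (fun n : nat => n.+1%:R^-1 *: map_mx intr (\col_i Num.floor (n.+1%:R * v i 0)))
    @ \oo --> v.
Proof.
apply: cvg_mx => i j; rewrite (ord1 j).
apply/cvgrPdist_le => e e0; near=> n; rewrite !mxE.
have n0 : 0 < n.+1%:R :> R by [].
have -> : v i 0 - n.+1%:R^-1 * (Num.floor (n.+1%:R * v i 0))%:~R =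
    n.+1%:R^-1 * (n.+1%:R * v i 0 - (Num.floor (n.+1%:R * v i 0))%:~R).
  by rewrite mulrBr mulKf ?gt_eqF.
rewrite normrM ger0_norm ?invr_ge0 ?ler0n//.
apply: (@le_trans _ _ n.+1%:R^-1).
  rewrite ler_piMr ?invr_ge0 ?ler0n// ger0_norm ?subr_ge0 ?floor_le//.
  by rewrite lerBlDl; apply: ltW; rewrite -[X in _ + X]/(1%:~R) -intrD floorD1_gt.
apply: ltW; near: n; exact: (near_infty_natSinv_lt (PosNum e0)).
Unshelve. all: by end_near. Qed.

(* By continuity and homogeneity, integer vectors suffice. *)
Lemma psdmx_int (R : realType) d (P : 'M[R]_d) : P^T = P ->
  (forall w : 'cV[int]_d, 0 <= inner (P *m map_mx intr w) (map_mx intr w)) -> psdmx P.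
Proof.
move=> Ps Pw; split=> // v.
pose w n : 'cV[int]_d := \col_i Num.floor (n.+1%:R * v i 0).
pose u n : 'cV[R]_d := n.+1%:R^-1 *: map_mx intr (w n).
have uv : u @ \oo --> v by exact: (@truncated_vector_cvg R d v).
have cP : (fun=> P) @ \oo --> P by exact: cvg_cst.
have cu : (fun n => inner (P *m u n) (u n)) @ \oo --> inner (P *m v) v.
  by apply: cvg_inner; [apply: cvg_mulmx; [exact: cP|exact: uv]|exact: uv].
rewrite -(cvg_lim (@Rhausdorff R) cu); apply: limr_ge.
  by apply/cvg_ex; eexists; exact: cu.
apply: nearW => n; rewrite /u -scalemxAr innerZl innerZr.
by rewrite !mulr_ge0 ?invr_ge0 ?ler0n.
Qed.

Section Density.
Context {R : realType} {d : nat}.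
Variable G : psdMeasure R d.
Local Open Scope charge_scope.

(** A positive semidefinite matrix of zero trace is zero. This is what allows [density] to be a
    Radon-Nikodym derivative. *)
Lemma entry_dominates i j : entry G i j `<< trace_measure G.
Proof.
apply/null_content_dominatesP => A mA [trA]; rewrite /entry.
by rewrite (psd_tr_eq0 (mval_psd G A) trA) mxE.
Qed.

Lemma density_EFin i j x :
  (density G x i j)%:E = ('d (entry G i j) '/d (trace_measure G)) x.
Proof. by rewrite mxE fineK// Radon_Nikodym_fin_num//; exact: entry_dominates. Qed.

Lemma integrable_density i j A : measurable A ->
  (trace_measure G).-integrable A (fun x => (density G x i j)%:E).
Proof.
move=> mA; apply: (@integrableS _ _ _ _ setT) => //.
rewrite (_ : (fun x => _) = 'd (entry G i j) '/d (trace_measure G)).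
  by apply: Radon_Nikodym_integrable; exact: entry_dominates.
by apply/funext => x; exact: density_EFin.
Qed.

Lemma measurable_density i j : measurable_fun setT (fun x => density G x i j).
Proof.
apply/measurable_EFinP; apply: (measurable_int (trace_measure G)).
exact: integrable_density.
Qed.

Lemma integral_density i j A : measurable A ->
  (\int[trace_measure G]_(x in A) (density G x i j)%:E = (G A i j)%:E)%E.
Proof.
move=> mA; under eq_integral do rewrite density_EFin.
by rewrite -Radon_Nikodym_integral//; exact: entry_dominates.
Qed.

Lemma integrable_inner_density (M : 'M[R]_d) A : measurable A ->
  (trace_measure G).-integrable A (fun x => (inner M (density G x))%:E).
Proof.
move=> mA; under eq_fun do rewrite innerE -sumEFin.
apply: integrable_sum => // i _; under eq_fun do rewrite -sumEFin.
apply: integrable_sum => // j _; under eq_fun do rewrite EFinM.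
by apply: integrableZl => //; exact: integrable_density.
Qed.

Lemma integral_inner_density (M : 'M[R]_d) A : measurable A ->
  (\int[trace_measure G]_(x in A) (inner M (density G x))%:E =
    (inner M (G A))%:E)%E.
Proof.
move=> mA; under eq_integral do rewrite innerE -sumEFin.
rewrite innerE -sumEFin integral_sum//; last first.
  move=> i; under eq_fun do rewrite -sumEFin.
  apply: integrable_sum => // j _; under eq_fun do rewrite EFinM.
  by apply: integrableZl => //; exact: integrable_density.
apply: eq_bigr => i _; under eq_integral do rewrite -sumEFin.
rewrite integral_sum//; last first.
  move=> j; under eq_fun do rewrite EFinM.
  by apply: integrableZl => //; exact: integrable_density.
rewrite -sumEFin; apply: eq_bigr => j _; under eq_integral do rewrite EFinM.
by rewrite integralZl ?integral_density ?EFinM//; exact: integrable_density.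
Qed.

Lemma density_sym_ae :
  {ae trace_measure G, forall x, (density G x)^T = density G x}.
Proof.
have e i j : {ae trace_measure G, forall x, density G x i j = density G x j i}.
  have : ae_eq (trace_measure G) setT (fun x => (density G x i j)%:E)
      (fun x => (density G x j i)%:E).
    apply: integral_ae_eq => //.
    - exact: integrable_density.
    - by apply/measurable_EFinP; exact: measurable_density.
    - move=> A _ mA; rewrite !integral_density//.
      by rewrite -[in LHS](mval_psd G A).1 mxE.
  by apply: filterS => x /(_ I) [].
have : {ae trace_measure G, forall x (i j : 'I_d), density G x i j = density G x j i}.
  have : \forall x \ae trace_measure G, forall i : 'I_d, forall j,
      density G x i j = density G x j i.
    apply: filter_forall => i; exact: filter_forall.
  by [].
by apply: filterS => x h; apply/matrixP => i j; rewrite mxE h.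
Qed.

(** Each test vector has its own exceptional null set. Integer vectors form a countable type, so the
    union over them, indexed through [pickle], is still null, and [psdmx_int] recovers all real
    vectors. *)
Lemma density_psd_ae : {ae trace_measure G, forall x, psdmx (density G x)}.
Proof.
pose q (w : 'cV[int]_d) x :=
  inner (density G x *m map_mx intr w) (map_mx intr w).
have qE w x : q w x = inner (map_mx intr w *m (map_mx intr w)^T) (density G x).
  by rewrite innerC /inner trmx_mul trmxK mulmxA.
have q0 (w : 'cV[int]_d) : {ae trace_measure G, forall x, 0 <= q w x}.
  apply: ae_ge0_integral_ge0.
    by rewrite /comp; under eq_fun do rewrite qE; exact: integrable_inner_density.
  move=> A mA; under eq_integral do rewrite qE.
  rewrite integral_inner_density// lee_fin innerC.
  have := psd_inner_ge0 (map_mx intr w) (mval_psd G A).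
  by rewrite /inner trmx_mul trmxK mulmxA.
have : {ae trace_measure G, forall x (n : nat),
    if unpickle n is Some w then 0 <= q w x else true}.
  by apply: ae_foralln => n; case: unpickle => [w|]; [exact: q0|exact: aeW].
apply: filterS2 density_sym_ae => x xs xq.
by apply: psdmx_int => // w; have := xq (pickle w); rewrite pickleK.
Qed.

Lemma ae_integrable (f h : 'cV[R]_d -> R) : measurable_fun setT f ->
  (trace_measure G).-integrable setT (EFin \o h) ->
  {ae trace_measure G, forall x, f x = h x} ->
  (trace_measure G).-integrable setT (EFin \o f).
Proof.
move=> mf /integrableP[/measurable_EFinP mh hoo] fh; apply/integrableP; split.
  exact/measurable_EFinP.
rewrite (ae_eq_integral (abse \o (EFin \o h)))//.
- by apply: measurableT_comp => //; exact/measurable_EFinP.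
- by apply: measurableT_comp => //; exact/measurable_EFinP.
- by apply: filterS fh => x /= ->.
Qed.

(** The density is set to 0 on a null set, so that positivity holds at every point and pointwise
    inequalities can be integrated directly. *)
Lemma psd_density_exists : exists g : 'cV[R]_d -> 'M[R]_d,
  [/\ forall x, psdmx (g x), forall i j, measurable_fun setT (fun x => g x i j) &
      {ae trace_measure G, forall x, g x = density G x}].
Proof.
have [N [mN N0 psdN]] := density_psd_ae.
exists (fun x => if x \in N then 0 else density G x); split.
- move=> x; case: ifPn => [_|xN]; first exact: psdmx0.
  by apply: contrapT => xP; move: xN; rewrite (mem_set (psdN _ xP)).
- move=> i j.
  rewrite (_ : (fun x => _) = (fun x => density G x i j) \_ (~` N)); last first.
    apply/funext => x; rewrite /patch in_setC.
    by case: ifPn => //= _; rewrite mxE.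
  apply/(measurable_restrictT _ _).1; first exact: measurableC.
  apply: measurable_funTS; exact: measurable_density.
- exists N; split=> // x /= xg; apply: contrapT => xN; apply: xg.
  by case: ifPn => // /set_mem.
Qed.

Lemma int_sq_psd n (g : 'cV[R]_d -> 'M[R]_d) (U : 'cV[R]_d -> 'M[R]_(d, n)) :
  (forall i j, measurable_fun setT (fun x => g x i j)) ->
  {ae trace_measure G, forall x, g x = density G x} ->
  (forall i j, measurable_fun setT (fun x => U x i j)) ->
  int_sq G U = (\int[trace_measure G]_x (inner (g x *m U x) (U x))%:E)%E.
Proof.
move=> mg gE mU; apply: ae_eq_integral => //.
- apply/measurable_EFinP/measurable_inner => //.
  by apply: measurable_mulmx => //; exact: measurable_density.
- by apply/measurable_EFinP/measurable_inner => //; exact: measurable_mulmx.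
- by apply: filterS gE => x ->.
Qed.

Lemma int_sq_ge0 n (U : 'cV[R]_d -> 'M[R]_(d, n)) :
  (forall i j, measurable_fun setT (fun x => U x i j)) -> (0 <= int_sq G U)%E.
Proof.
move=> mU; have [g [gp mg gE]] := psd_density_exists.
rewrite (int_sq_psd mg gE)//; apply: integral_ge0 => x _.
by rewrite lee_fin psd_inner_ge0.
Qed.

Lemma int_mx_cst (M : 'M[R]_d) : int_mx G (fun=> M) = inner M (G setT).
Proof. by rewrite /int_mx /Rintegral integral_inner_density. Qed.

Lemma int_scalar1 : int_scalar G (fun=> 1) = G setT.
Proof.
apply/matrixP => i j; rewrite mxE /Rintegral.
by under eq_integral do rewrite mul1r; rewrite integral_density.
Qed.

(** The last term depends only on the total mass because [Phi] is constant in space. Apart from the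
    case of infinite [int_sq G U], the inequality [psd_Young] is integrated for a density that is
    positive everywhere. *)
Lemma int_pair_Young (U : 'cV[R]_d -> 'M[R]_d) (Phi : 'M[R]_d) : Phi^T = Phi ->
  (forall i j, measurable_fun setT (fun x => U x i j)) ->
  ((int_pair G U (fun=> Phi))%:E <=
   int_sq G U + (4^-1 * inner (Phi *m Phi) (G setT))%:E)%E.
Proof.
move=> Phis mU; have [g [gp mg gE]] := psd_density_exists.
have sq0 := int_sq_ge0 mU.
have [sqoo|sqfin] := eqVneq (int_sq G U) +oo%E; first by rewrite sqoo addye// leey.
have mgU := measurable_mulmx mg mU.
have mf : measurable_fun setT (fun x => inner (g x *m U x) (U x)) by exact: measurable_inner.
have mk : measurable_fun setT (fun x => inner (g x *m U x) Phi) by exact: measurable_inner.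
have mp : measurable_fun setT (fun x => inner (g x *m Phi) Phi).
  by apply: measurable_inner => //; exact: measurable_mulmx.
have intf : (trace_measure G).-integrable setT (fun x => (inner (g x *m U x) (U x))%:E).
  apply/integrableP; split; first exact/measurable_EFinP.
  under eq_integral => x _ do rewrite gee0_abs ?lee_fin ?psd_inner_ge0//.
  by rewrite -(int_sq_psd mg gE)// ltey.
have pE x : inner (density G x *m Phi) Phi = inner (Phi *m Phi) (density G x).
  by rewrite inner_mulr Phis innerC.
have intp : (trace_measure G).-integrable setT (fun x => (4^-1 * inner (g x *m Phi) Phi)%:E).
  under eq_fun do rewrite EFinM; apply: integrableZl => //.
  apply: (@ae_integrable _ (fun x => inner (Phi *m Phi) (density G x))) => //.
    exact: integrable_inner_density.
  by apply: filterS gE => x ->; exact: pE.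
have kle V x : inner (g x *m U x) V <=
  inner (g x *m U x) (U x) + 4^-1 * inner (g x *m V) V by exact: psd_Young.
(* Young's inequality for [Phi] and for [- Phi] dominates the absolute value of the pairing. *)
have intk : (trace_measure G).-integrable setT (fun x => (inner (g x *m U x) Phi)%:E).
  apply: (le_integrable measurableT _ _ (integrableD measurableT intf intp)).
    exact/measurable_EFinP.
  move=> x _ /=; rewrite lee_fin ler_norml (le_trans _ (ler_norm _)) ?andbT//.
  rewrite lerNl -innerNr; apply: le_trans (ler_norm _).
  by have := kle (- Phi) x; rewrite mulmxN innerNl !innerNr opprK.
have -> : (int_pair G U (fun=> Phi))%:E =
    (\int[trace_measure G]_x (inner (g x *m U x) Phi)%:E)%E.
  rewrite /int_pair /Rintegral.
  rewrite (ae_eq_integral (fun x => (inner (g x *m U x) Phi)%:E))//.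
  - by rewrite fineK//; exact: integrable_fin_num.
  - apply/measurable_EFinP/measurable_inner => //.
    by apply: measurable_mulmx => //; exact: measurable_density.
  - exact/measurable_EFinP.
  - by apply: filterS gE => x ->.
have -> : (4^-1 * inner (Phi *m Phi) (G setT))%:E =
    (\int[trace_measure G]_x (4^-1 * inner (g x *m Phi) Phi)%:E)%E.
  under [RHS]eq_integral do rewrite EFinM.
  rewrite integralZl//; last first.
    apply: (@ae_integrable _ (fun x => inner (Phi *m Phi) (density G x))) => //.
      exact: integrable_inner_density.
    by apply: filterS gE => x ->; exact: pE.
  rewrite EFinM; congr (_ * _)%E; rewrite -integral_inner_density//.
  apply: ae_eq_integral => //.
  - by apply: (measurable_int (trace_measure G)); exact: integrable_inner_density.
  - exact/measurable_EFinP.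
  - by apply: filterS gE => x ->; rewrite pE.
rewrite (int_sq_psd mg gE)// -integralD//.
apply: le_integral => //; first exact: integrableD.
by move=> x _; rewrite -EFinD lee_fin.
Qed.

End Density.

(** * The lower bound for the Kantorovich-Bures distance *)

Section TimeFields.
Context {R : realType} {d : nat}.

Lemma derive_fst m n (g : R -> 'M[R]_(m, n)) (p v : R * 'cV[R]_d) :
  'D_v (g \o fst) p = 'D_(v.1) g p.1.
Proof. by []. Qed.

Lemma derive_scale1 m n (g : R -> 'M[R]_(m, n)) (t a : R) dg :
  is_derive t 1 g dg -> 'D_a g t = a *: dg.
Proof.
move=> [dgt <-]; have dfg : differentiable g t by exact/derivable1_diffP.
by rewrite !deriveE// -[in LHS](mulr1 a) -/(a *: (1 : R)) linearZ.
Qed.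

Lemma bounded_inP (T : Type) (V : normedModType R) (A : set T) (f : T -> V) :
  [bounded f x | x in A] <-> exists M : R, forall x, A x -> `|f x| <= M.
Proof.
split=> [[M [_ Mb]]|[M Mb]].
  by exists (`|M| + 1) => x; apply: Mb; rewrite (le_lt_trans (ler_norm M))// ltrDl.
by exists M; split=> [|K MK x Ax]; [exact: num_real|exact: le_trans (Mb _ Ax) (ltW MK)].
Qed.

Lemma within_bounded m n (g : R -> 'M[R]_(m, n)) (a b : R) :
  {within `[a, b], continuous g} -> [bounded g t | t in `[a, b]].
Proof.
move=> cg; have /compact_bounded[M [Mr Mb]] := continuous_compact cg (@segment_compact _ a b).
by exists M; split=> // K MK t tab; apply: Mb => //; exists t.
Qed.

(** The derivative along [v] is [v.1 *: dg], so all requirements reduce to one real variable, and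
    the bounds come from compactness of [[0, 1]]. *)
Lemma C1b_time m n (g dg : R -> 'M[R]_(m, n)) (e : R) : 0 < e ->
  (forall t, - e < t < 1 + e -> is_derive t 1 g (dg t)) ->
  (forall t, - e < t < 1 + e -> {for t, continuous dg}) ->
  C1b (d := d) (g \o fst).
Proof.
move=> e0 dgE cdg.
have itv01 t : t \in `[0, 1] -> - e < t < 1 + e.
  by rewrite in_itv /= => /andP[? ?]; apply/andP; split; lra.
have bg : [bounded g t | t in (`[0, 1] : set R)].
  apply: within_bounded; apply: derivable_within_continuous => t /itv01 /dgE.
  by case.
have bdg : [bounded dg t | t in (`[0, 1] : set R)].
  apply: within_bounded; apply: continuous_in_subspaceT => t; rewrite inE => /itv01.
  exact: cdg.
split.
- exists e => // p pe; split.
    apply: differentiable_comp.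
      by apply: linear_differentiable => q; exact: cvg_fst.
    by apply/derivable1_diffP; case: (dgE _ pe).
  move=> v; rewrite /prop_for /=.
  suff h : v.1 *: dg q.1 @[q --> p] --> v.1 *: dg p.1.
    rewrite /continuous_at derive_fst (derive_scale1 _ (dgE _ pe)).
    apply: cvg_trans h; apply: near_eq_cvg; near=> q.
    rewrite derive_fst (derive_scale1 _ (dgE _ _))//.
    near: q.
    have e1 : \forall t \near p.1, - e < t < 1 + e.
      have := @near_in_itvoo R (- e) (1 + e) p.1; rewrite in_itv /= => /(_ pe).
      by apply: filterS => t; rewrite in_itv.
    have cf : fst @ p --> p.1 by exact: cvg_fst.
    exact: (cf _ e1).
  apply: cvgZ; first exact: cvg_cst.
  apply: (@cvg_comp _ _ _ fst dg (nbhs p) (nbhs p.1)); first exact: cvg_fst.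
  exact: cdg.
- case: bg => M [Mr Mb]; exists M; split=> // K MK -[t x] [/= t01 _].
  exact: Mb.
- move=> v; have [M Mb] := (bounded_inP _ _).1 bdg.
  apply/bounded_inP; exists (`|v.1| * M) => -[t x] [/= t01 _].
  rewrite derive_fst /= (derive_scale1 _ (dgE _ (itv01 _ t01))) normrZ.
  by rewrite ler_wpM2l//; exact: Mb.
Unshelve. all: by end_near. Qed.

End TimeFields.

Section LowerBound.
Context {R : realType} {d : nat}.

(** [C1b] asks for regularity on a neighbourhood of the strip, whereas positivity holds on [[0, 1]];
    invertibility extends past both ends by continuity of the determinant. *)
Lemma interp_mx_unit_near (T : 'M[R]_d) : pdmx T ->
  exists2 e : R, 0 < e & forall t, - e < t < 1 + e -> interp_mx T t \in unitmx.
Proof.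
move=> Tp.
have near_unit (s : R) : 0 <= s <= 1 -> \forall t \near s, interp_mx T t \in unitmx.
  move=> s01; have cd : \det (interp_mx T t) @[t --> s] --> \det (interp_mx T s).
    by apply: cvg_det; exact: continuous_interp_mx.
  have : \det (interp_mx T s) != 0.
    by have := pd_unitmx (interp_mx_pd Tp s01); rewrite unitmxE unitfE.
  move=> /(cvgr_neq0 _ cd); apply: filterS => t.
  by rewrite unitmxE unitfE.
have /nbhs_ballP[e0 /= e0p h0] : \forall t \near (0 : R), interp_mx T t \in unitmx.
  by apply: near_unit; rewrite lexx ler01.
have /nbhs_ballP[e1 /= e1p h1] : \forall t \near (1 : R), interp_mx T t \in unitmx.
  by apply: near_unit; rewrite lexx ler01.
exists (Num.min e0 e1) => [|t /andP[te et]]; first by rewrite lt_min e0p e1p.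
have [m0 m1] : Num.min e0 e1 <= e0 /\ Num.min e0 e1 <= e1 by rewrite !ge_min !lexx orbT.
have [t0|t0] := ltP t 0.
  by apply: h0; rewrite /ball /= sub0r normrN ltr0_norm//; lra.
have [t1|t1] := ltP 1 t; last by apply/pd_unitmx/interp_mx_pd; rewrite ?t0.
by apply: h1; rewrite /ball /= distrC ger0_norm ?subr_ge0 1?ltW//; lra.
Qed.

Lemma continuous_calib (T : 'M[R]_d) (t : R) : interp_mx T t \in unitmx ->
  {for t, continuous (calib T)}.
Proof. by move=> /is_derive_calib; exact: is_derive_continuous. Qed.

Definition calib_velocity (T : 'M[R]_d) (t : R) : 'M[R]_d :=
  - 4^-1 *: (calib T t *m calib T t).

Lemma continuous_calib_velocity (T : 'M[R]_d) (t : R) : interp_mx T t \in unitmx ->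
  {for t, continuous (calib_velocity T)}.
Proof.
move=> /continuous_calib ct; apply: cvgZ; first exact: cvg_cst.
by apply: cvg_mulmx.
Qed.

Lemma C1b_calib (T : 'M[R]_d) : pdmx T -> C1b (d := d) (calib T \o fst).
Proof.
move=> /interp_mx_unit_near[e e0 Tu]; apply: (C1b_time (dg := calib_velocity T) e0).
- by move=> t /Tu; exact: is_derive_calib.
- by move=> t /Tu; exact: continuous_calib_velocity.
Qed.

Lemma measurable_field_slice m n (f : R * 'cV[R]_d -> 'M[R]_(m, n)) (t : R) i j :
  measurable_field f -> 0 <= t <= 1 ->
  measurable_fun setT (fun x => at_time f t x i j).
Proof.
move=> mf t01; apply: (measurable_comp (F := strip) (f := fun p => f p i j)).
- by apply: measurableX => //; exact: measurable_itv.
- by move=> _ [x _ <-]; split=> //=; rewrite in_itv.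
- exact: mf.
- exact: pair1_measurable.
Qed.

Lemma L2sq_ge_bures_cost (P0 P1 : 'M[R]_d) (G0 G1 : psdMeasure R d) G U u :
  pdmx P0 -> pdmx P1 -> G0 setT = P0 -> G1 setT = P1 ->
  admissible G0 G1 G U u -> ((bures_cost P0 P1)%:E <= L2sq G U u)%E.
Proof.
move=> P0p P1p G0E G1E [cG GG0 GG1 [_ [mU mu] fin _] wG].
have [Tp TP] := transportP P0p P1p; set T := transport P0 P1 in Tp TP.
have Tu t : 0 <= t <= 1 -> interp_mx T t \in unitmx.
  by move=> t01; exact/pd_unitmx/interp_mx_pd.
have dPhi t x v : 0 <= t <= 1 ->
    'D_v (calib T \o fst) ((t, x) : R * 'cV[R]_d) = v.1 *: calib_velocity T t.
  by move=> /Tu ut; rewrite derive_fst; exact/derive_scale1/is_derive_calib.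
have i01 : 0 <= (0 : R) <= 1 by rewrite lexx ler01.
have i11 : 0 <= (1 : R) <= 1 by rewrite ler01 lexx.
pose f1 r := inner (calib_velocity T r) (G r setT).
pose f2 r := int_pair (G r) (at_time U r) (fun=> calib T r).
have Phis : symmetric_on_strip (calib T \o fst : R * 'cV[R]_d -> _).
  by move=> p _; exact: calib_sym.
have := wG _ (C1b_calib Tp) Phis 0 1 i01 i11.
rewrite /oriented_integral ler01.
rewrite /at_time /= !int_mx_cst GG0// GG1// G0E G1E.
have -> : Rintegral lebesgue_measure `[0, 1] (fun r => int_mx (G r)
    (fun x => time_derivative (calib T \o fst) (r, x))) =
    Rintegral lebesgue_measure `[0, 1] f1.
  apply: eq_Rintegral => r; rewrite inE /= in_itv /= => r01.
  rewrite /f1 -int_mx_cst; congr int_mx; apply/funext => x.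
  by rewrite /time_derivative dPhi// scale1r.
have -> : Rintegral lebesgue_measure `[0, 1] (fun r =>
    int_pair (G r) (fun x => u (r, x)) (fun x => divergence (calib T \o fst) (r, x)) +
    int_pair (G r) (fun x => U (r, x)) (fun x => calib T r)) =
    Rintegral lebesgue_measure `[0, 1] f2.
  apply: eq_Rintegral => r; rewrite inE /= in_itv /= => r01.
  rewrite -[RHS]add0r; congr (_ + _).
  rewrite /int_pair /Rintegral integral0_eq// => x _.
  rewrite (_ : divergence _ _ = 0) ?(innerC _ 0) ?inner0l//.
  apply/matrixP => i j; rewrite !mxE big1// => k _.
  by rewrite dPhi// scale0r mxE.
move=> wE.
have -> : bures_cost P0 P1 = Rintegral lebesgue_measure `[0, 1] f1 +
    Rintegral lebesgue_measure `[0, 1] f2.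
  rewrite -wE addrC subrK /bures_cost -/T -calib_boundary ?TP//; exact: P0p.1.
have sq0 n r (V : R * 'cV[R]_d -> 'M[R]_(d, n)) : 0 <= r <= 1 -> measurable_field V ->
    (0 <= int_sq (G r) (at_time V r))%E.
  by move=> r01 mV; apply: int_sq_ge0 => i j; exact: measurable_field_slice.
(* Narrow continuity against the constant function 1 is continuity of the total mass, which makes
   [f1] integrable in time. *)
have cGT : {within `[0, 1], continuous (fun r => G r setT)}.
  rewrite (_ : (fun r => _) = fun r => int_scalar (G r) (fun=> 1)); last first.
    by apply/funext => r; rewrite int_scalar1.
  apply: cG; first exact: (@cst_continuous _ _ (1 : R)).
  by apply/bounded_inP; exists 1 => x _; rewrite normr1.
apply: Rintegral_lower_bound => //.
- apply: itv_integrable => r; apply: cvg_inner.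
    move: r; apply: continuous_in_subspaceT => r; rewrite inE /= in_itv /= => /Tu.
    exact: continuous_calib_velocity.
  exact: cGT.
(* The equation for [calib] makes [- f1] equal to the quarter term of Young's inequality, in
   particular nonnegative. *)
- move=> r _; rewrite /f1 /calib_velocity innerZl mulNr oppr_le0 mulr_ge0//.
  by rewrite innerC -{2}(calib_sym Tp) -inner_mulr psd_inner_ge0//; exact: mval_psd.
- by move=> r; rewrite /= in_itv /= => r01; rewrite adde_ge0 ?sq0.
- move=> r; rewrite /= in_itv /= => r01.
  have Y : ((f2 r)%:E <= int_sq (G r) (at_time U r) +
      (4^-1 * inner (calib T r *m calib T r) (G r setT))%:E)%E.
    apply: int_pair_Young; first exact: calib_sym.
    by move=> i j; exact: measurable_field_slice.
  rewrite /f1 /calib_velocity innerZl mulNr opprK; apply: (le_trans Y).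
  by apply: leeD => //; apply: leeDr; exact: sq0.
Qed.

End LowerBound.

(** * Constant multiples of a probability measure *)

Section ScaledMeasure.
Context {R : realType} {d : nat}.
Variable (lambda : probability 'cV[R]_d R).
Implicit Types P : pdMatrix R d.

Lemma pd_tr_gt0 (P : 'M[R]_d) : (0 < d)%N -> pdmx P -> 0 < \tr P.
Proof.
move=> d0 Pp; suff : 0 < inner (P *m 1%:M) 1%:M by rewrite /inner trmx1 !mulmx1.
apply: pd_inner_gt0 => //; apply/eqP => /matrixP/(_ (Ordinal d0) (Ordinal d0)).
by rewrite !mxE eqxx; apply/eqP; rewrite oner_eq0.
Qed.

Lemma trace_scaled_measure P A : measurable A ->
  trace_measure (scaled_measure P lambda) A = ((\tr P)%:E * lambda A)%E.
Proof.
move=> mA; rewrite /trace_measure /= /scaled_val mxtraceZ mulrC EFinM fineK//.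
exact: fin_num_measure.
Qed.

Lemma ge0_integral_scaled_measure P (f : 'cV[R]_d -> R) :
  (forall x, 0 <= f x) -> measurable_fun setT f ->
  (\int[trace_measure (scaled_measure P lambda)]_x (f x)%:E =
   (\tr P)%:E * \int[lambda]_x (f x)%:E)%E.
Proof.
move=> f0 mf; have trP : 0 <= \tr P by exact/psdmx_tr/pd_psd/pdvalP.
rewrite (@eq_measure_integral _ _ _ _ (mscale (NngNum trP) lambda))/=; last first.
  by move=> A mA _; rewrite trace_scaled_measure.
rewrite ge0_integral_mscale//; first exact/measurable_EFinP.
by move=> x _; rewrite lee_fin.
Qed.

Lemma Rintegral_scaled_measure P (f : 'cV[R]_d -> R) :
  lambda.-integrable setT (EFin \o f) ->
  Rintegral (trace_measure (scaled_measure P lambda)) setT f =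
  \tr P * Rintegral lambda setT f.
Proof.
move=> intf; have mf : measurable_fun setT f.
  by apply/measurable_EFinP; apply: (measurable_int lambda); exact: intf.
have pE : (EFin \o f)^\+%E = (fun x => (Num.max (f x) 0)%:E).
  by apply/funext => x; rewrite funeposE EFin_max.
have nE : (EFin \o f)^\-%E = (fun x => (Num.max (- f x) 0)%:E).
  by apply/funext => x; rewrite funenegE EFin_max.
have := integrable_pos_fin_num measurableT intf.
have := integrable_neg_fin_num measurableT intf.
rewrite pE nE => fn fp; rewrite /Rintegral integralE [in RHS]integralE pE nE.
rewrite !ge0_integral_scaled_measure//; last 4 first.
- by move=> x; rewrite le_max lexx orbT.
- by apply: measurable_maxr => //; exact: measurableT_comp.
- by move=> x; rewrite le_max lexx orbT.
- exact: measurable_maxr.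
by rewrite -(fineK fp) -(fineK fn) -!EFinM -!EFinB /= mulrBr.
Qed.

Hypothesis d_gt0 : (0 < d)%N.

(** The trace measure is [\tr P] times [lambda], so the density is [P] normalized by its trace;
    [0 < d] makes that trace positive. *)
Lemma density_scaled_measure P : {ae trace_measure (scaled_measure P lambda),
  forall x, density (scaled_measure P lambda) x = (\tr P)^-1 *: pdval P}.
Proof.
have e i j : {ae trace_measure (scaled_measure P lambda), forall x,
    density (scaled_measure P lambda) x i j = ((\tr P)^-1 *: pdval P) i j}.
  have : ae_eq (trace_measure (scaled_measure P lambda)) setT
      (fun x => (density (scaled_measure P lambda) x i j)%:E)
      (cst (((\tr P)^-1 *: pdval P) i j)%:E).
    apply: integral_ae_eq => //.
    - exact: integrable_density.
    - move=> A _ mA; rewrite integral_density// integral_cst//=.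
      rewrite trace_scaled_measure// /scaled_val !mxE -(fineK (fin_num_measure lambda A mA)).
      rewrite -!EFinM; congr (_%:E); field.
      by rewrite gt_eqF//; apply: pd_tr_gt0 => //; exact: pdvalP.
  by apply: filterS => x /(_ I) [].
have : \forall x \ae trace_measure (scaled_measure P lambda), forall i : 'I_d, forall j,
    density (scaled_measure P lambda) x i j = ((\tr P)^-1 *: pdval P) i j.
  by apply: filter_forall => i; exact: filter_forall.
by apply: filterS => x h; apply/matrixP => i j; rewrite h.
Qed.

(** All integrands of interest are homogeneous in the density, so the mass [\tr P] of the trace
    measure cancels the normalization of the density. *)
Lemma Rintegral_density_scaled P (F : 'cV[R]_d -> 'M[R]_d -> R) :
  measurable_fun setT (fun x => F x (density (scaled_measure P lambda) x)) ->
  (forall a x, F x (a *: pdval P) = a * F x P) ->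
  lambda.-integrable setT (fun x => (F x P)%:E) ->
  Rintegral (trace_measure (scaled_measure P lambda)) setT
    (fun x => F x (density (scaled_measure P lambda) x)) =
  Rintegral lambda setT (fun x => F x P).
Proof.
move=> mF FZ intF.
have intFV : lambda.-integrable setT (EFin \o (fun x => F x ((\tr P)^-1 *: pdval P))).
  rewrite (_ : _ \o _ = fun x => (((\tr P)^-1)%:E * (F x P)%:E)%E); last first.
    by apply/funext => x /=; rewrite FZ EFinM.
  exact: integrableZl.
transitivity (Rintegral (trace_measure (scaled_measure P lambda)) setT
    (fun x => F x ((\tr P)^-1 *: pdval P))).
  congr fine; apply: ae_eq_integral => //.
  - exact/measurable_EFinP.
  - exact: (measurable_int lambda).
  - by apply: filterS (density_scaled_measure P) => x ->.
rewrite Rintegral_scaled_measure//.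
have -> : Rintegral lambda setT (fun x => F x ((\tr P)^-1 *: pdval P)) =
    (\tr P)^-1 * Rintegral lambda setT (fun x => F x P).
  by rewrite -RintegralZl//; apply: eq_Rintegral => x _; rewrite FZ.
rewrite mulVKf//.
by rewrite gt_eqF//; apply: pd_tr_gt0 => //; exact: pdvalP.
Qed.

End ScaledMeasure.

(** * Differentiation under the integral sign *)

Section DifferentiationUnderIntegral.
Context {R : realType} dY (Y : measurableType dY) (lambda : probability Y R).

Lemma bounded_integrable (f : Y -> R) (K : R) : measurable_fun setT f ->
  (forall y, `|f y| <= K) -> lambda.-integrable setT (EFin \o f).
Proof.
move=> mf fK; apply: measurable_bounded_integrable => //.
  by apply: le_lt_trans (probability_le1 lambda measurableT) _; exact: ltry.
by apply/bounded_inP; exists K => y _; exact: fK.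
Qed.

Lemma continuous_clamp_integral (f : R -> Y -> R) (s t K : R) : s <= t ->
  (forall r, s <= r <= t -> measurable_fun setT (f r)) ->
  (forall r y, s <= r <= t -> `|f r y| <= K) ->
  (forall r y, s <= r <= t -> {for r, continuous (f^~ y)}) ->
  continuous (fun r => Rintegral lambda setT (f (clamp s t r))).
Proof.
move=> st mf fK cf r.
apply: (@continuity_under_integral _ _ _ lambda (fun r => f (clamp s t r)) setT
    measurableT (r - 1) (r + 1) _ _ (cst K)).
- move=> x _; apply: (@bounded_integrable _ K); first exact/mf/clamp_in.
  by move=> y; exact/fK/clamp_in.
- apply: aeW => y _ x _; apply: (@continuous_comp _ _ _ (clamp s t) (f^~ y)).
    exact: continuous_clamp.
  exact/cf/clamp_in.
- by apply: (@bounded_integrable (cst K) `|K|).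
- by move=> x _; apply: aeW => y _; exact/fK/clamp_in.
- by rewrite inE /= in_itv /=; apply/andP; split; lra.
Qed.

(** The integral of [f r] is differentiated inside []s, t[] under the domination by [K], and the
    fundamental theorem is applied to the result. Clamping supplies continuity at [s] and [t]. *)
Lemma FTC_under_integral (f df : R -> Y -> R) (s t K : R) : s < t ->
  (forall r, s <= r <= t -> measurable_fun setT (f r)) ->
  (forall r, s <= r <= t -> measurable_fun setT (df r)) ->
  (forall r y, s <= r <= t -> `|f r y| <= K) ->
  (forall r y, s <= r <= t -> `|df r y| <= K) ->
  (forall r y, s <= r <= t -> is_derive r 1 (f^~ y) (df r y)) ->
  (forall r y, s <= r <= t -> {for r, continuous (df^~ y)}) ->
  Rintegral lebesgue_measure `[s, t] (fun r => Rintegral lambda setT (df r)) =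
  Rintegral lambda setT (f t) - Rintegral lambda setT (f s).
Proof.
move=> st mf mdf fK dfK fE cdf; have st' := ltW st.
have cf r y : s <= r <= t -> {for r, continuous (f^~ y)}.
  by move=> /(fE r y); exact: is_derive_continuous.
pose F r := Rintegral lambda setT (f (clamp s t r)).
pose DF r := Rintegral lambda setT (df (clamp s t r)).
have cF : continuous F by apply: (@continuous_clamp_integral f s t K).
have cDF : continuous DF by apply: (@continuous_clamp_integral df s t K).
have dF r : s < r < t -> is_derive r 1 F (DF r).
  move=> srt.
  have srt' x : s < x < t -> s <= x <= t by case/andP => /ltW -> /ltW ->.
  have fcE x y : s < x < t ->
      is_derive x 1 (fun z => f (clamp s t z) y) (df x y).
    move=> xst; apply: near_eq_is_derive (fE x y (srt' _ xst)).
    apply: (near_itvoo_eq (a := s) (b := t)) => // z /srt' zst.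
    by rewrite clamp_id.
  have Ir : (`]s, t[%classic : set R) r by rewrite /= in_itv.
  have If x : (`]s, t[%classic : set R) x ->
      lambda.-integrable setT (EFin \o f (clamp s t x)).
    move=> _; apply: (@bounded_integrable _ K); first exact/mf/clamp_in.
    by move=> y; exact/fK/clamp_in.
  have Df x y : (`]s, t[%classic : set R) x -> setT y ->
      derivable (fun z => f (clamp s t z) y) x 1.
    by rewrite /= in_itv /= => /(fcE x y)[].
  have K0 (y : Y) : 0 <= K.
    by apply: le_trans (normr_ge0 _) (fK s y _); rewrite lexx.
  have bK x y : (`]s, t[%classic : set R) x -> setT y ->
      `|partial1of2 (fun z => f (clamp s t z)) x y| <= K.
    rewrite /= in_itv /= => xst _; rewrite partial1of2E.
    by have [_ ->] := fcE x y xst; exact/dfK/srt'.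
  have iK : lambda.-integrable setT (EFin \o cst K).
    by apply: (@bounded_integrable (cst K) `|K|).
  apply: DeriveDef; first exact: (derivable_under_integral measurableT Ir If Df K0 iK bK).
  rewrite -derive1E (differentiation_under_integral measurableT Ir If Df K0 iK bK).
  apply: eq_Rintegral => y _; rewrite partial1of2E.
  by have [_ ->] := fcE r y srt; rewrite clamp_id ?srt'.
have -> : Rintegral lambda setT (f t) = F t by rewrite /F clamp_id ?lexx ?st'.
have -> : Rintegral lambda setT (f s) = F s by rewrite /F clamp_id ?lexx ?st'.
transitivity (Rintegral lebesgue_measure `[s, t] DF).
  apply: eq_Rintegral => r; rewrite inE /= in_itv /= => srt.
  by rewrite /DF clamp_id.
rewrite /Rintegral (@continuous_FTC2 _ DF F)//.
- exact: continuous_subspaceT.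
- split.
  + by move=> r; rewrite in_itv /= => /dF[].
  + exact/cvg_at_right_filter/cF.
  + exact/cvg_at_left_filter/cF.
- by move=> r; rewrite in_itv /= => /dF[_ <-]; rewrite derive1E.
Qed.

End DifferentiationUnderIntegral.

(** * The optimal path of matrix measures *)

Section TestFields.
Context {R : realType} {d : nat}.

Lemma measurable_continuous_vector (f : 'cV[R]_d -> R) :
  continuous f -> measurable_fun setT f.
Proof.
move=> /continuousP cf; apply: (measurability _ (RGenOpens.measurableE R)).
move=> _ [_ [a [b ->] <-]]; rewrite setTI.
by apply: sub_sigma_algebra; apply: cf; exact: interval_open.
Qed.

Lemma continuous_pairl (t : R) : continuous (fun x : 'cV[R]_d => (t, x)).
Proof.
move=> x; apply: (@cvg_pair _ _ _ (nbhs x) (nbhs t) (nbhs x) _ _ _ (cst t) id).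
  exact: cvg_cst.
exact: cvg_id.
Qed.

Lemma continuous_pairr (x : 'cV[R]_d) : continuous (fun t : R => (t, x)).
Proof.
move=> t; apply: (@cvg_pair _ _ _ (nbhs t) (nbhs t) (nbhs x) _ _ _ id (cst x)).
  exact: cvg_id.
exact: cvg_cst.
Qed.

Lemma mx_entry_le_norm m n (A : 'M[R]_(m, n)) i j : `|A i j| <= `|A|.
Proof.
by rewrite {2}/Num.norm /= mx_normrE; exact: (le_bigmax _ (fun k => `|A k.1 k.2|) (i, j)).
Qed.

Lemma inner_norm_le m n (A B : 'M[R]_(m, n)) :
  `|inner A B| <= (m * n)%:R * (`|A| * `|B|).
Proof.
rewrite innerE; apply: le_trans (ler_norm_sum _ _ _) _.
apply: (@le_trans _ _ (\sum_(i < m) \sum_(j < n) `|A| * `|B|)).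
  apply: ler_sum => i _; apply: le_trans (ler_norm_sum _ _ _) _.
  by apply: ler_sum => j _; rewrite normrM ler_pM ?mx_entry_le_norm.
by rewrite !sumr_const !card_ord -mulrnA mulnC mulr_natl.
Qed.

Variables (m n : nat) (Phi : R * 'cV[R]_d -> 'M[R]_(m, n)).
Hypothesis PhiC1 : C1b Phi.

Lemma C1b_is_derive_time (t : R) x : 0 <= t <= 1 ->
  is_derive t 1 (fun r => Phi (r, x)) (time_derivative Phi (t, x)).
Proof.
move=> t01; have [[e e0 Phie] _ _] := PhiC1.
have te : - e < (t, x).1 < 1 + e by case/andP: t01 => /= ? ?; apply/andP; split; lra.
have [dPhi _] := Phie _ te.
have lineE : (fun h : R => h^-1 *: (Phi (h *: (1, 0) + (t, x)) - Phi (t, x))) =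
    (fun h : R => h^-1 *: (((fun r => Phi (r, x)) \o shift t) (h *: 1) - Phi (t, x))).
  apply/funext => h; congr (_ *: (Phi _ - _)).
  by congr pair; rewrite /= ?scaler0 ?add0r.
have : derivable Phi (t, x) (1, 0) by exact: diff_derivable.
rewrite /derivable /= lineE => dPhit; apply: DeriveDef; first exact: dPhit.
by rewrite /time_derivative /derive /= lineE.
Qed.

Lemma C1b_continuous_space (t : R) : 0 <= t <= 1 -> continuous (at_time Phi t).
Proof.
move=> t01 x; have [[e e0 Phie] _ _] := PhiC1.
have te : - e < (t, x).1 < 1 + e by case/andP: t01 => /= ? ?; apply/andP; split; lra.
have [/differentiable_continuous cPhi _] := Phie _ te.
by apply: (continuous_comp (f := fun y => (t, y)) (g := Phi)) => //; exact: continuous_pairl.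
Qed.

Lemma C1b_derive_continuous (t : R) x v : 0 <= t <= 1 ->
  {for (t, x), continuous (fun p => 'D_v Phi p)}.
Proof.
move=> t01; have [[e e0 Phie] _ _] := PhiC1.
have te : - e < (t, x).1 < 1 + e by case/andP: t01 => /= ? ?; apply/andP; split; lra.
by have [_ /(_ v)] := Phie _ te.
Qed.

Lemma C1b_derive_continuous_space (t : R) v : 0 <= t <= 1 ->
  continuous (at_time (fun p => 'D_v Phi p) t).
Proof.
move=> t01 x; apply: (continuous_comp (f := fun y => (t, y)) (g := 'D_v Phi)).
  exact: continuous_pairl.
exact: C1b_derive_continuous.
Qed.

Lemma C1b_derive_continuous_time (t : R) x v : 0 <= t <= 1 ->
  {for t, continuous (fun r => 'D_v Phi (r, x))}.
Proof.
move=> t01; apply: (continuous_comp (f := fun r => (r, x)) (g := 'D_v Phi)).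
  exact: continuous_pairr.
exact: C1b_derive_continuous.
Qed.

End TestFields.

Lemma measurable_continuous_mx (R : realType) d m n (f : 'cV[R]_d -> 'M[R]_(m, n)) i j :
  continuous f -> measurable_fun setT (fun x => f x i j).
Proof.
move=> cf; apply: measurable_continuous_vector => x.
exact/cvg_mx_entry/cf.
Qed.

Section ScaledIntegrals.
Context {R : realType} {d : nat}.
Variables (lambda : probability 'cV[R]_d R) (P : pdMatrix R d).
Hypothesis d_gt0 : (0 < d)%N.

Lemma int_mx_scaled_measure (Phi : 'cV[R]_d -> 'M[R]_d) (K : R) :
  (forall i j, measurable_fun setT (fun x => Phi x i j)) ->
  (forall x, `|Phi x| <= K) ->
  int_mx (scaled_measure P lambda) Phi =
  Rintegral lambda setT (fun x => inner (Phi x) P).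
Proof.
move=> mPhi PhiK.
rewrite /int_mx (@Rintegral_density_scaled _ _ lambda d_gt0 P (fun x g => inner (Phi x) g))//.
- by apply: measurable_inner => // i j; exact: measurable_density.
- by move=> a x; rewrite innerZr.
- apply: (@bounded_integrable _ _ _ lambda _ ((d * d)%:R * (K * `|pdval P|))).
    by apply: measurable_inner => // i j; exact: measurable_cst.
  move=> x; apply: le_trans (inner_norm_le _ _) _.
  by rewrite ler_wpM2l// ler_wpM2r.
Qed.

Lemma int_pair_scaled_measure (M : 'M[R]_d) (V : 'cV[R]_d -> 'M[R]_d) (K : R) :
  (forall i j, measurable_fun setT (fun x => V x i j)) ->
  (forall x, `|V x| <= K) ->
  int_pair (scaled_measure P lambda) (fun=> M) V =
  Rintegral lambda setT (fun x => inner (P *m M) (V x)).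
Proof.
move=> mV VK.
rewrite /int_pair (@Rintegral_density_scaled _ _ lambda d_gt0 P
  (fun x g => inner (g *m M) (V x)))//.
- apply: measurable_inner => //; apply: measurable_mulmx; first exact: measurable_density.
  by move=> i j; exact: measurable_cst.
- by move=> a x; rewrite -scalemxAl innerZl.
- apply: (@bounded_integrable _ _ _ lambda _ ((d * d)%:R * (`|pdval P *m M| * K))).
    by apply: measurable_inner => // i j; exact: measurable_cst.
  move=> x; apply: le_trans (inner_norm_le _ _) _.
  by rewrite ler_wpM2l// ler_wpM2l.
Qed.

Lemma int_scalar_scaled_measure (phi : 'cV[R]_d -> R) (K : R) :
  measurable_fun setT phi -> (forall x, `|phi x| <= K) ->
  int_scalar (scaled_measure P lambda) phi = Rintegral lambda setT phi *: pdval P.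
Proof.
move=> mphi phiK; apply/matrixP => i j; rewrite !mxE.
have iphi := bounded_integrable lambda mphi phiK.
rewrite (@Rintegral_density_scaled _ _ lambda d_gt0 P (fun x g => phi x * g i j))//.
- by rewrite RintegralZr.
- by apply: measurable_funM => //; exact: measurable_density.
- by move=> a x; rewrite mxE mulrCA.
- by under eq_fun do rewrite EFinM; exact: integrableZr.
Qed.

Lemma int_sq_cst_scaled_measure (M : 'M[R]_d) :
  int_sq (scaled_measure P lambda) (fun=> M) = (inner (P *m M) M)%:E.
Proof.
have e (g : 'M[R]_d) : inner (g *m M) M = inner (M *m M^T) g by rewrite inner_mulr innerC.
rewrite /int_sq; under eq_integral do rewrite e.
rewrite integral_inner_density// e /=; congr (inner _ _)%:E.
by rewrite /scaled_val probability_setT scale1r.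
Qed.

End ScaledIntegrals.

Lemma int_sq0 (R : realType) d n (G : psdMeasure R d) :
  int_sq (n := n) G (fun=> 0) = 0%E.
Proof. by apply: integral0_eq => x _; rewrite mulmx0 inner0l. Qed.

Section OptimalMeasurePath.
Context {R : realType} {d : nat}.
Variable lambda : probability 'cV[R]_d R.
Hypothesis d_gt0 : (0 < d)%N.

(** Exchanging [s] and [t] changes the sign of both sides, and both vanish for [s = t]. *)
Lemma oriented_integral_balance (A g1 g2 : R -> R) :
  (forall s t, 0 <= s -> s < t -> t <= 1 ->
    A t - A s - Rintegral lebesgue_measure `[s, t] g1 =
    Rintegral lebesgue_measure `[s, t] g2) ->
  forall s t, 0 <= s <= 1 -> 0 <= t <= 1 ->
    A t - A s - oriented_integral s t g1 = oriented_integral s t g2.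
Proof.
move=> Ag s t /andP[s0 s1] /andP[t0 t1]; rewrite /oriented_integral.
have [st|ts|->] := ltgtP s t.
- exact: Ag.
- by rewrite -(Ag t s)//; lra.
- by rewrite subrr set_itv1 !Rintegral_set1 subrr.
Qed.

Lemma within_integral_continuous (f : R -> 'cV[R]_d -> R) (s t K : R) : s <= t ->
  (forall r, s <= r <= t -> measurable_fun setT (f r)) ->
  (forall r y, s <= r <= t -> `|f r y| <= K) ->
  (forall r y, s <= r <= t -> {for r, continuous (f^~ y)}) ->
  {within `[s, t], continuous (fun r => Rintegral lambda setT (f r))}.
Proof.
move=> st mf fK cf.
have cF : {within `[s, t], continuous (fun r => Rintegral lambda setT (f (clamp s t r)))}.
  by apply: continuous_subspaceT; apply: (@continuous_clamp_integral _ _ _ lambda f s t K).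
apply: subspace_eq_continuous cF => r; rewrite inE /= in_itv /= => srt.
by rewrite /from_subspace clamp_id.
Qed.

Variables T P0 : 'M[R]_d.
Hypotheses (Tp : pdmx T) (P0p : pdmx P0).
Local Notation c := (bures_path T P0).
Local Notation v := (bures_path_velocity T P0).

Lemma bures_path_velocity_sym r : (v r)^T = v r.
Proof.
rewrite /bures_path_velocity linearD /= !trmx_mul interp_mx_sym// P0p.1.
by rewrite linearB /= trmx1 Tp.1 !mulmxA addrC.
Qed.

Lemma continuous_bures_path : continuous c.
Proof. by move=> r; apply: is_derive_continuous; exact: is_derive_bures_path. Qed.

Lemma continuous_bures_path_velocity : continuous v.
Proof.
have [_] := C1_bures_path T P0; rewrite (_ : derive1 _ = v)//.
by apply/funext => r; rewrite derive1E; case: (is_derive_bures_path T P0 r).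
Qed.

(** A symmetric test matrix sees only the symmetric part of [c r *m U], which is the velocity by the
    Lyapunov equation. *)
Lemma bures_path_inner_velocity r (Phi : 'M[R]_d) : 0 <= r <= 1 -> Phi^T = Phi ->
  inner Phi (v r) = inner (c r *m (2^-1 *: calib T r)) Phi.
Proof.
move=> r01 Phis; rewrite -(bures_path_lyapunov Tp P0p r01).
by apply: lyapunov_inner => //; [exact: bures_path_pd|exact: bures_path_velocity_sym].
Qed.

Variable cP : R -> pdMatrix R d.
Hypothesis cPE : forall r, 0 <= r <= 1 -> pdval (cP r) = c r.

(** With zero transport velocity the weak equation is the product rule for
    [inner (Phi (r, x)) (c r)], integrated in space against [lambda] and then in time. *)
Lemma bures_path_weak_solution :
  weak_solution (fun r => scaled_measure (cP r) lambda)
    ((fun r => 2^-1 *: calib T r) \o fst) (cst 0).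
Proof.
move=> Phi PhiC1 Phis; apply: oriented_integral_balance => s t s0 st t1.
have in01 r : s <= r <= t -> 0 <= r <= 1.
  by move=> /andP[sr rt]; rewrite (le_trans s0 sr) (le_trans rt t1).
have [K [K0 PhiK dPhiK cK vK]] : exists K, [/\ 0 <= K,
    forall r x, 0 <= r <= 1 -> `|Phi (r, x)| <= K,
    forall r x, 0 <= r <= 1 -> `|time_derivative Phi (r, x)| <= K,
    forall r, 0 <= r <= 1 -> `|c r| <= K & forall r, 0 <= r <= 1 -> `|v r| <= K].
  have [_ /bounded_inP[K1 PhiK] /(_ (1, 0))/bounded_inP[K2 dPhiK]] := PhiC1.
  have /within_bounded/bounded_inP[K3 cK] : {within `[0, 1], continuous c}.
    exact/continuous_subspaceT/continuous_bures_path.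
  have /within_bounded/bounded_inP[K4 vK] : {within `[0, 1], continuous v}.
    exact/continuous_subspaceT/continuous_bures_path_velocity.
  have := (ler_norm K1, ler_norm K2, ler_norm K3, ler_norm K4).
  have := (normr_ge0 K1, normr_ge0 K2, normr_ge0 K3, normr_ge0 K4).
  move=> [[[k1 k2] k3] k4] [[[l1 l2] l3] l4].
  exists (`|K1| + `|K2| + `|K3| + `|K4|); split; first lra.
  - move=> r x r01; apply: (@le_trans _ _ K1); last lra.
    by apply: (PhiK (r, x)); split=> //=; rewrite in_itv.
  - move=> r x r01; apply: (@le_trans _ _ K2); last lra.
    by apply: (dPhiK (r, x)); split=> //=; rewrite in_itv.
  - move=> r r01; apply: (@le_trans _ _ K3); last lra.
    by apply: cK; rewrite /= in_itv.
  - move=> r r01; apply: (@le_trans _ _ K4); last lra.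
    by apply: vK; rewrite /= in_itv.
have mPhi r i j : 0 <= r <= 1 -> measurable_fun setT (fun x => Phi (r, x) i j).
  by move=> r01; apply: measurable_continuous_mx; exact: C1b_continuous_space PhiC1 _ r01.
have mdPhi r i j : 0 <= r <= 1 ->
    measurable_fun setT (fun x => time_derivative Phi (r, x) i j).
  move=> r01; apply: measurable_continuous_mx.
  exact: (@C1b_derive_continuous_space _ _ _ _ _ PhiC1 r (1, 0) r01).
(* f is the integrand of tr (Phi G), and its time derivative is g1 + g2. *)
pose g1 (r : R) (x : 'cV[R]_d) : R := inner (time_derivative Phi (r, x)) (c r).
pose g2 (r : R) (x : 'cV[R]_d) : R := inner (Phi (r, x)) (v r).
pose f (r : R) (x : 'cV[R]_d) : R := inner (Phi (r, x)) (c r).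
pose N : R := (d * d)%:R * (K * K).
have N0 : 0 <= N by rewrite !mulr_ge0.
have bN (A B : 'M[R]_d) : `|A| <= K -> `|B| <= K -> `|inner A B| <= N.
  move=> AK BK; apply: le_trans (inner_norm_le _ _) _.
  by rewrite ler_wpM2l// ler_pM.
have fN r x : s <= r <= t -> `|f r x| <= N by move=> /in01 r01; apply: bN; auto.
have g1N r x : s <= r <= t -> `|g1 r x| <= N by move=> /in01 r01; apply: bN; auto.
have g2N r x : s <= r <= t -> `|g2 r x| <= N by move=> /in01 r01; apply: bN; auto.
have mf r : s <= r <= t -> measurable_fun setT (f r).
  by move=> /in01 r01; apply: measurable_inner => i j; [exact: mPhi|exact: measurable_cst].
have mg1 r : s <= r <= t -> measurable_fun setT (g1 r).
  by move=> /in01 r01; apply: measurable_inner => i j; [exact: mdPhi|exact: measurable_cst].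
have mg2 r : s <= r <= t -> measurable_fun setT (g2 r).
  by move=> /in01 r01; apply: measurable_inner => i j; [exact: mPhi|exact: measurable_cst].
have dPhi (r : R) x : 0 <= r <= 1 ->
    is_derive r 1 (fun z => Phi (z, x)) (time_derivative Phi (r, x)).
  by move=> r01; exact: C1b_is_derive_time.
have cg1 (r : R) x : s <= r <= t -> {for r, continuous (g1^~ x)}.
  move=> /in01 r01; apply: cvg_inner; last exact: continuous_bures_path.
  exact: (@C1b_derive_continuous_time _ _ _ _ _ PhiC1 r x (1, 0) r01).
have cg2 (r : R) x : s <= r <= t -> {for r, continuous (g2^~ x)}.
  move=> /in01 r01; apply: cvg_inner; last exact: continuous_bures_path_velocity.
  exact: is_derive_continuous (dPhi r x r01).
have ig1 r : s <= r <= t -> lambda.-integrable setT (EFin \o g1 r).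
  by move=> rst; apply: (@bounded_integrable _ _ _ lambda _ N); [exact: mg1|move=> x; exact: g1N].
have ig2 r : s <= r <= t -> lambda.-integrable setT (EFin \o g2 r).
  by move=> rst; apply: (@bounded_integrable _ _ _ lambda _ N); [exact: mg2|move=> x; exact: g2N].
have Ig1 : lebesgue_measure.-integrable `[s, t]
    (EFin \o (fun r => Rintegral lambda setT (g1 r))).
  by apply: itv_integrable; apply: (@within_integral_continuous g1 s t N) => //; exact: ltW.
have Ig2 : lebesgue_measure.-integrable `[s, t]
    (EFin \o (fun r => Rintegral lambda setT (g2 r))).
  by apply: itv_integrable; apply: (@within_integral_continuous g2 s t N) => //; exact: ltW.
have fE r : s <= r <= t ->
    int_mx (scaled_measure (cP r) lambda) (at_time Phi r) = Rintegral lambda setT (f r).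
  move=> /in01 r01; rewrite (@int_mx_scaled_measure _ _ _ _ d_gt0 _ K) ?cPE//.
    by move=> i j; exact: mPhi.
  by move=> x; exact: PhiK.
have FTC : Rintegral lebesgue_measure `[s, t]
    (fun r => Rintegral lambda setT (fun x => g1 r x + g2 r x)) =
    Rintegral lambda setT (f t) - Rintegral lambda setT (f s).
  apply: (@FTC_under_integral _ _ _ lambda f (fun r x => g1 r x + g2 r x) s t (N + N)) => //.
  - by move=> r rst; apply: measurable_funD; [exact: mg1|exact: mg2].
  - by move=> r x rst; apply: le_trans (fN r x rst) _; rewrite lerDl.
  - by move=> r x rst; apply: le_trans (ler_normD _ _) _; rewrite lerD ?g1N ?g2N.
  - move=> r x /in01 r01.
    exact: is_derive_inner (dPhi r x r01) (is_derive_bures_path T P0 r).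
  - by move=> r x rst; apply: cvgD; [exact: cg1|exact: cg2].
rewrite !fE ?lexx ?ltW// -FTC.
have -> : Rintegral lebesgue_measure `[s, t]
      (fun r => Rintegral lambda setT (fun x => g1 r x + g2 r x)) =
    Rintegral lebesgue_measure `[s, t] (fun r => Rintegral lambda setT (g1 r)) +
    Rintegral lebesgue_measure `[s, t] (fun r => Rintegral lambda setT (g2 r)).
  rewrite -RintegralD//; apply: eq_Rintegral => r; rewrite inE /= in_itv /= => rst.
  by rewrite RintegralD//; [exact: ig1|exact: ig2].
have -> : Rintegral lebesgue_measure `[s, t] (fun r =>
      int_mx (scaled_measure (cP r) lambda) (at_time (time_derivative Phi) r)) =
    Rintegral lebesgue_measure `[s, t] (fun r => Rintegral lambda setT (g1 r)).
  apply: eq_Rintegral => r; rewrite inE /= in_itv /= => /in01 r01.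
  rewrite (@int_mx_scaled_measure _ _ _ _ d_gt0 _ K) ?cPE//.
    by move=> i j; exact: mdPhi.
  by move=> x; exact: dPhiK.
rewrite addrC addKr; apply: eq_Rintegral => r; rewrite inE /= in_itv /= => /in01 r01.
rewrite [int_pair _ _ _](_ : _ = 0) ?add0r; last first.
  by rewrite /int_pair /Rintegral integral0_eq// => x _; rewrite mulmx0 inner0l.
rewrite -[RHS]/(int_pair (scaled_measure (cP r) lambda) (fun=> 2^-1 *: calib T r)
  (at_time Phi r)).
rewrite (@int_pair_scaled_measure _ _ _ _ d_gt0 _ _ K).
- apply: eq_Rintegral => x _; rewrite /g2 bures_path_inner_velocity ?cPE//.
  by apply: Phis; split=> //=; rewrite in_itv.
- by move=> i j; exact: mPhi.
- by move=> x; exact: PhiK.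
Qed.

End OptimalMeasurePath.

(** * The distances between multiples of lambda *)

Section KantorovichBuresDistance.
Context {R : realType} {d : nat}.
Variable lambda : probability 'cV[R]_d R.
Hypothesis d_gt0 : (0 < d)%N.

Lemma optimal_path_L2_field T P0 (c : R -> pdMatrix R d) : pdmx T ->
  (forall r, 0 <= r <= 1 -> pdval (c r) = bures_path T P0 r) ->
  let G r := scaled_measure (c r) lambda in
  let U := (fun r => 2^-1 *: calib T r) \o fst in
  L2sq G U (cst 0) = (4 * inner (P0 *m (T - 1%:M)) (T - 1%:M))%:E /\
  L2_field G U (cst 0).
Proof.
move=> Tp cE G U.
have Us p : (U p)^T = U p by rewrite /U /= linearZ /= calib_sym.
have LE : L2sq G U (cst 0) = (4 * inner (P0 *m (T - 1%:M)) (T - 1%:M))%:E.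
  transitivity (\int[lebesgue_measure]_(t in `[0%R, 1%R])
      (cst (4 * inner (P0 *m (T - 1%:M)) (T - 1%:M))%:E t))%E.
    apply: eq_integral => r; rewrite inE /= in_itv /= => r01.
    rewrite -(inner_bures_path_calib P0 Tp r01) -cE//.
    rewrite -(int_sq_cst_scaled_measure lambda).
    by rewrite [X in (X + _)%E](int_sq0 1 (G r)) add0e.
  rewrite integral_cst//= lebesgue_measure_itv/= lte_fin ltr01.
  by rewrite -EFinB subr0 mule1.
have C10 n : C1b (cst 0 : R * 'cV[R]_d -> 'M[R]_(d, n)).
  apply: (@C1b_time R d d n (cst 0) (cst 0) 1 ltr01) => t _.
  exact: (@cst_continuous _ _ (0 : 'M[R]_(d, n))).
have C1U : C1b U.
  have [e e0 Tu] := interp_mx_unit_near Tp.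
  apply: (C1b_time (dg := fun r => 2^-1 *: calib_velocity T r) e0) => t /Tu ut.
    exact: is_deriveZ (is_derive_calib ut).
  by apply: cvgZ; [exact: cvg_cst|exact: continuous_calib_velocity].
split=> //; split.
- by move=> p _; exact: Us.
- split=> i j; last exact: measurable_cst.
  apply: (measurable_comp (F := (`[0, 1]%classic : set R))
    (f := fun r => (2^-1 *: calib T r) i j)) => //.
  + by move=> _ [[r x] [/= r01 _] <-].
  + apply: subspace_continuous_measurable_fun => //.
    apply: continuous_in_subspaceT => r; rewrite inE /= in_itv /= => r01.
    apply: cvg_mx_entry; apply: cvgZ; first exact: cvg_cst.
    exact/continuous_calib/pd_unitmx/interp_mx_pd.
  + exact: measurable_funTS.
- by rewrite LE ltry.
(* The field is itself of class [C1b], so it serves as its own approximation. *)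
- move=> e e0; exists U, (cst 0); split=> //.
  rewrite /L2sq integral0_eq ?lte_fin// => r _.
  rewrite (_ : at_time _ r = fun=> 0); last by apply/funext => x; rewrite /at_time /= subrr.
  rewrite [X in (_ + int_sq _ X)%E](_ : _ = fun=> 0); last first.
    by apply/funext => x; rewrite /at_time /= subrr.
  by rewrite !int_sq0 adde0.
Qed.

Lemma optimal_path_exists (P0 P1 : pdMatrix R d) : exists G U,
  admissible (scaled_measure P0 lambda) (scaled_measure P1 lambda) G U (cst 0) /\
  L2sq G U (cst 0) = (bures_cost P0 P1)%:E.
Proof.
have [P0p P1p] := (pdvalP P0, pdvalP P1); have [Tp TP] := transportP P0p P1p.
have [c [cE c0 c1]] := bures_path_connects P0p P1p.
have [LE L2U] := optimal_path_L2_field Tp cE.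
do 2!eexists; split; last exact: LE.
split; [| | |exact: L2U|exact: (bures_path_weak_solution lambda d_gt0 Tp P0p cE)].
(* The integral of [phi] is a fixed scalar times the matrix path, so narrow continuity is continuity
   of that path. *)
- move=> phi cphi /bounded_inP[K phiK].
  have cF : {within `[0, 1], continuous (fun r =>
      Rintegral lambda setT phi *: bures_path (transport P0 P1) P0 r)}.
    apply: continuous_subspaceT => r; apply: cvgZ; first exact: cvg_cst.
    exact: continuous_bures_path.
  apply: subspace_eq_continuous cF => r; rewrite inE /= in_itv /= => r01.
  rewrite /from_subspace (@int_scalar_scaled_measure _ _ _ _ d_gt0 _ K) ?cE//.
    exact: measurable_continuous_vector.
  by move=> x; exact: phiK.
- by move=> A mA; rewrite /= /scaled_val c0.
- by move=> A mA; rewrite /= /scaled_val c1.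
Qed.

Lemma scaled_measure_setT (P : pdMatrix R d) : scaled_measure P lambda setT = pdval P.
Proof. by rewrite /= /scaled_val probability_setT scale1r. Qed.

Lemma ereal_inf_attained (S : set (\bar R)) (a : \bar R) : S a ->
  (forall x, S x -> (a <= x)%E) -> ereal_inf S = a.
Proof.
move=> Sa aS; apply/eqP; rewrite eq_le; apply/andP; split.
  exact: ereal_inf_lbound.
exact: le_ereal_inf_tmp.
Qed.

Lemma KB_distE (P0 P1 : pdMatrix R d) :
  KB_dist (scaled_measure P0 lambda) (scaled_measure P1 lambda) =
  (Num.sqrt (bures_cost P0 P1))%:E.
Proof.
have [G [U [aGU LE]]] := optimal_path_exists P0 P1.
rewrite /KB_dist (@ereal_inf_attained _ (bures_cost P0 P1)%:E)//.
  by exists G, U, (cst 0); split; last exact: esym LE.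
move=> _ [G' [U' [u [aG' ->]]]].
by apply: L2sq_ge_bures_cost aG'; rewrite ?scaled_measure_setT//; exact: pdvalP.
Qed.

Lemma H_distE (P0 P1 : pdMatrix R d) :
  H_dist (scaled_measure P0 lambda) (scaled_measure P1 lambda) =
  (Num.sqrt (bures_cost P0 P1))%:E.
Proof.
have [G [U [aGU LE]]] := optimal_path_exists P0 P1.
rewrite /H_dist (@ereal_inf_attained _ (bures_cost P0 P1)%:E)//.
  by exists G, U, (cst 0); split=> //; exact: esym LE.
move=> _ [G' [U' [u [aG' _ ->]]]].
by apply: L2sq_ge_bures_cost aG'; rewrite ?scaled_measure_setT//; exact: pdvalP.
Qed.

End KantorovichBuresDistance.

Theorem mainTheorem7 (R : realType) (d : nat) (d_ge1 : (1 <= d)%N)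
    (lambda : probability 'cV[R]_d R) :
  (forall c : R -> pdMatrix R d, geodesic bures_dist c ->
     geodesic KB_dist (fun t => scaled_measure (c t) lambda))
  /\
  (forall P0 P1 : pdMatrix R d,
     bures_dist P0 P1
       = KB_dist (scaled_measure P0 lambda) (scaled_measure P1 lambda)
     /\
     KB_dist (scaled_measure P0 lambda) (scaled_measure P1 lambda)
       = H_dist (scaled_measure P0 lambda) (scaled_measure P1 lambda)).
Proof.
split=> [c [L cL]|P0 P1]; last by rewrite bures_distE KB_distE// H_distE.
(* A geodesic is defined by mutual distances alone, so the equality of distances transfers it with
   the same speed [L]. *)
by exists L => s t s01 t01; rewrite KB_distE// -bures_distE cL.
Qed.
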